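(* There is an absolute constant $c>0$ such that every connected vertex-transitive graph on $n\geq 3$ vertices contains a cycle of length at least $c\, n^{13/21}$.
   Context: The paper states this as ''a cycle of length at least $\Omega(n^{13/21})$''; graphs are finite and simple, and the length of a cycle is its number of edges (equivalently, vertices). *)

(* Defs.v *)
From HB Require Import structures.
From mathcomp Require Import all_boot all_order all_algebra all_fingroup.
From mathcomp Require Import reals exp.

Set Implicit Arguments.
Unset Strict Implicit.
Unset Printing Implicit Defensive.

(* A finite simple graph is a finType of vertices together with an adjacency
   relation satisfying [simple_graph]. *)
Definition simple_graph (T : finType) (e : rel T) : Prop :=
  symmetric e /\ irreflexive e.

Definition connected_graph (T : finType) (e : rel T) : Prop :=
  forall x y : T, connect e x y.

Definition graph_automorphism (T : finType) (e : rel T) (g : {perm T}) : Prop :=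
  forall x y : T, e (g x) (g y) = e x y.

Definition vertex_transitive (T : finType) (e : rel T) : Prop :=
  forall x y : T, exists g : {perm T}, graph_automorphism e g /\ g x = y.

(* [ucycle] also holds of the empty sequence and of the two ends of an edge,
   hence the lower bound on the size.  The sequence lists each vertex of the
   cycle once, so its size is the length of the cycle. *)
Definition graph_cycle (T : finType) (e : rel T) (p : seq T) : Prop :=
  ucycle e p /\ 3 <= size p.

(* Main.v *)
Require Import Defs.
From HB Require Import structures.
From mathcomp Require Import all_boot all_order all_algebra all_fingroup.
From mathcomp Require Import reals exp.
From mathcomp Require Import zify ring.
From mathcomp Require boolp.

Set Implicit Arguments.
Unset Strict Implicit.
Unset Printing Implicit Defensive.

(* Let l be the length of a longest cycle and n the number of vertices.  There are no
   cut vertices, so any two longest cycles meet.  By averaging over the automorphism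
   group, some translate D of a longest cycle C shares k <= l^2 / n vertices with C.
   A set S of fewer than n / l vertices is missed by some translate of C; this
   translate meets both C and D, so S does not separate them, and Menger's theorem
   gives n / l disjoint paths between C and D.

   It remains to see that two longest cycles with k common vertices are joined by only
   O(k^(8/5)) disjoint paths; then n / l = O((l^2 / n)^(8/5)), that is
   n^13 = O(l^21).  Cut C and D into O(k) segments that contain no common vertices
   and the same number of attachments each, and let the paths be the edges of a
   bipartite graph on the segments.  Given a cycle in this graph, one can exchange the
   pieces of the segments of C between the attachments for those of D, and conversely.
   If both exchanges produce a single cycle, then the two new cycles are together
   longer than C and D, a contradiction.  Hence in a 4-cycle the attachments cannot be
   ordered in the same way both on the two segments of C and on those of D.  As in
   the Erdos-Simonovits bound for the cube, more than O(k^(8/5)) edges would force a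
   hexagon in the graph between the neighbourhoods of the ends of an edge.  The rule
   for 4-cycles leaves few possible orders of its attachments, and in each of them
   some exchange along a hexagon or an octagon succeeds both ways, which is checked by
   computation. *)

(** * Exchanging arcs between two cycles *)

Section Tours.
Variable K : eqType.
Implicit Types (L : seq K) (u : K).

(* [L] lists the attachments of some paths in their cyclic order on a cycle.  The
   arcs that start at an even position are the inner ones: they lie inside a
   segment, so they may be used together with the rest of the other cycle. *)
Definition inner L u := if odd (index u L) then prev L u else next L u.
Definition outer L u := if odd (index u L) then next L u else prev L u.

(** This parity check lets each arc that a tour uses be charged to exactly one of its two ends. *)
Definition alternating (f : K -> K) L :=
  all (fun u => odd (index (f u) L) != odd (index u L)) L.

(* The outer arcs of [L], the inner arcs of [L'] and all the paths, each attachment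
   in [L] being joined by a path to its namesake in [L'], form a single cycle. *)
Definition single_tour L L' :=
  if L is u0 :: _ then
    let g u := inner L' (outer L u) in
    let s := traject g u0 (size L)./2 in
    [&& iter (size L)./2 g u0 == u0, perm_eq (s ++ map (outer L) s) L,
        alternating (outer L) L & alternating (inner L') L']
  else false.

Definition good_swap L L' := single_tour L L' && single_tour L' L.

End Tours.

Section Swap.
Variables (T : finType) (e : rel T).
Hypothesis e_sym : symmetric e.
Variable K : eqType.

(** [C] is recovered only up to permutation, since the last arc may run through the end of the list
    [C] and on from its beginning. *)
Definition arcs_of (C : seq T) (x : K -> T) (L : seq K) (arc : K -> seq T) :=
  perm_eq C (flatten [seq x u :: arc u | u <- L]) /\
  {in L, forall u, path e (x u) (rcons (arc u) (x (next L u)))}.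

Lemma path_rev_sym x p y :
  path e x (rcons p y) = path e y (rcons (rev p) x).
Proof.
have := rev_path e x (rcons p y).
rewrite last_rcons belast_rcons rev_cons => ->.
by apply: eq_path => a b; rewrite e_sym.
Qed.

Lemma cycle_flatten (g : K -> K) (x : K -> T) (blk : K -> seq T) u0 n :
  0 < n -> iter n g u0 = u0 ->
  {in traject g u0 n, forall u, path e (x u) (rcons (blk u) (x (g u)))} ->
  path.cycle e (flatten [seq x u :: blk u | u <- traject g u0 n]).
Proof.
case: n => // n _ itn H.
suff Hp m u : {in traject g u m.+1, forall v, path e (x v) (rcons (blk v) (x (g v)))} ->
    path e (x u) (rcons (blk u ++ flatten [seq x v :: blk v | v <- traject g (g u) m])
       (x (iter m.+1 g u))).
  by rewrite /= -[X in rcons _ (x X)]itn; apply: Hp.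
elim: m u => [|m IHm] u Hu.
  by rewrite /= cats0; apply: Hu; rewrite /= inE eqxx.
rewrite trajectS /= rcons_cat rcons_cons -cat_rcons cat_path last_rcons.
rewrite Hu ?inE ?eqxx //=.
have := IHm (g u); rewrite -iterSr; apply=> v vin.
by apply: Hu; rewrite trajectS inE vin orbT.
Qed.

Section HalfTour.
Variables (C D : seq T) (x y : K -> T) (P : K -> seq T) (LC LD : seq K).
Variables (arcC arcD : K -> seq T).
Hypothesis eLCD : perm_eq LC LD.
Hypothesis uLC : uniq LC.
Hypothesis uC : uniq C.
Hypothesis uD : uniq D.
Hypothesis hC : arcs_of C x LC arcC.
Hypothesis hD : arcs_of D y LD arcD.
Hypothesis hP : {in LC, forall u, path e (x u) (rcons (P u) (y u))}.
Hypothesis PC : {in LC, forall u, {in P u, forall z, (z \notin C) && (z \notin D)}}.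
Hypothesis uP : uniq (flatten (map P LC)).
Hypothesis yC : {in LC, forall u, y u \notin C}.
Hypothesis arcDC : {in LD, forall u, ~~ odd (index u LD) ->
   {in arcD u, forall z, z \notin C}}.
Hypothesis tour : single_tour LC LD.

(** The number of vertices charged to [u] in the tour: both attachments, the interior of the path,
    and those arcs in use that start at [u]. *)
Definition half_weight u :=
  (2 + (if odd (index u LC) then size (arcC u) else 0)
   + (if odd (index u LD) then 0 else size (arcD u)) + size (P u))%N.

Let uLD : uniq LD. Proof. by rewrite -(perm_uniq eLCD). Qed.
Let mLCD : LC =i LD. Proof. exact: perm_mem. Qed.
Let o := outer LC.
Let i := inner LD.
Let g u := i (o u).
Let oarc u := if odd (index u LC) then arcC u else rev (arcC (prev LC u)).
Let iarc v := if odd (index v LD) then rev (arcD (prev LD v)) else arcD v.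

Let oin u : u \in LC -> o u \in LC.
Proof. by rewrite /o /outer; case: ifP; rewrite ?mem_next ?mem_prev. Qed.
Let iin u : u \in LC -> i u \in LC.
Proof. by rewrite !mLCD /i /inner; case: ifP; rewrite ?mem_next ?mem_prev. Qed.

Let oarcP u : u \in LC -> path e (x u) (rcons (oarc u) (x (o u))).
Proof.
move=> uin; rewrite /oarc /o /outer; case: ifP => _; first exact: hC.2.
rewrite path_rev_sym revK.
by have := hC.2 (prev LC u); rewrite mem_prev next_prev //; apply.
Qed.

Let iarcP u : u \in LC -> path e (y u) (rcons (iarc u) (y (i u))).
Proof.
rewrite mLCD => uin; rewrite /iarc /i /inner; case: ifP => _; last exact: hD.2.
rewrite path_rev_sym revK.
by have := hD.2 (prev LD u); rewrite mem_prev next_prev //; apply.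
Qed.

(** The tour repeats the block [blk u]: along [C] from [u] to [o u], over a path to [D], along [D]
    to [g u], and over a path back to [C]. By [single_tour] these blocks close up, and each label
    occurs once as [u] or as [o u]. *)
Lemma half_tour : exists Z : seq T,
  [/\ uniq Z, path.cycle e Z & size Z = \sum_(u <- LC) half_weight u].
Proof.
have [u0 [L' eL]] : exists u0, exists L', LC = u0 :: L'.
  by move: tour; rewrite /single_tour; case: (LC) => // a b; exists a, b.
have := tour; rewrite /single_tour [in X in X -> _]eL -eL.
rewrite -/o -/i; set n := (size LC)./2; set s := traject _ u0 n.
case/and4P=> /eqP itn sperm altC altD.
have sin u : u \in s -> u \in LC.
  by move=> us; rewrite -(perm_mem sperm) mem_cat us.
have n0 : 0 < n.
  case: (posnP n) => // n0; move: (perm_size sperm).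
  by rewrite size_cat size_map size_traject n0 eL.
pose blk u := oarc u ++ x (o u) :: P (o u) ++ y (o u) :: iarc (o u) ++ y (g u) :: rev (P (g u)).
have sumLC (F : K -> nat) : \sum_(u <- LC) F u = \sum_(u <- s) (F u + F (o u)).
  by rewrite -(perm_big _ sperm) big_cat big_map big_split.
(* As [g] only rotates the orbit [s], what belongs to [g u] may be charged to [u]. *)
have sumg (F : K -> nat) : \sum_(u <- s) F (g u) = \sum_(u <- s) F u.
  rewrite -(big_map g predT F) /=.
  have -> : map g s = rot 1 s.
    have : iter n g u0 = u0 by [].
    rewrite /s; case: (n) n0 => // k _ itk.
    rewrite [in RHS]trajectS rot1_cons -[X in rcons _ X]itk iterSr -trajectSr.
    by elim: k.+1 (u0) => //= m IH v; rewrite IH.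
  by apply: perm_big; rewrite perm_rot.
(* The vertices of the tour regrouped by label, from which both its size and the absence of
   repetitions are read off. *)
pose R u := x u :: y u :: (if odd (index u LC) then arcC u else [::]) ++
   (if odd (index u LD) then [::] else arcD u) ++ P u.
pose Z := flatten [seq x u :: blk u | u <- s].
have permZ : perm_eq Z (flatten (map R LC)).
  apply/seq.permP => a; rewrite !count_flatten !sumnE !big_map.
  rewrite sumLC.
  pose FC u := if odd (index u LC) then count a (arcC u) else 0.
  pose FD u := if odd (index u LD) then 0 else count a (arcD u).
  transitivity (\sum_(u <- s) ((a (x u) + a (x (o u)) + a (y (o u)) + count a (P (o u))
     + FC u + FC (o u) + FD (o u)) + (a (y (g u)) + count a (P (g u)) + FD (g u)))).
    apply: eq_big_seq => u us /=; have uL := sin _ us.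
    rewrite /blk !(count_cat, count_rev) /= !(count_cat, count_rev) /= !(count_cat, count_rev) /=.
    have -> : count a (oarc u) = FC u + FC (o u).
      have := allP altC _ uL; rewrite /FC /oarc /o /outer.
      by case: ifP => ou; case: ifP => // _ _; rewrite ?addn0 ?count_rev.
    have -> : count a (iarc (o u)) = FD (o u) + FD (g u).
      have := allP altD (o u); rewrite -mLCD oin // => /(_ isT); rewrite /FD /iarc /g /i /inner.
      by case: ifP => ou; case: ifP => // _ _; rewrite ?addn0 ?count_rev.
    rewrite count_rev; move: (FC u) (FC (o u)) (FD (o u)) (FD (g u)) (count a (P (o u))) (count a (P (g u))).
    by move: (nat_of_bool (a (x u))) (nat_of_bool (a (x (o u)))) (nat_of_bool (a (y (o u))))
      (nat_of_bool (a (y (g u)))); clear; lia.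
  rewrite big_split /= (sumg (fun u => a (y u) + count a (P u) + FD u)) -big_split /=.
  apply: eq_big_seq => u us /=; rewrite !count_cat.
  rewrite !(fun_if (count a)) /= -/(FC u) -/(FC (o u)).
  have eFD v : (if odd (index v LD) then 0 else count a (arcD v)) = FD v by [].
  rewrite !eFD; move: (FC u) (FC (o u)) (FD u) (FD (o u)) (count a (P u)) (count a (P (o u))).
  by move: (nat_of_bool (a (x u))) (nat_of_bool (a (x (o u)))) (nat_of_bool (a (y (o u))))
      (nat_of_bool (a (y u))); clear; lia.
exists Z; split.
- rewrite (perm_uniq permZ).
  pose R1 u := x u :: (if odd (index u LC) then arcC u else [::]).
  pose R2 u := y u :: (if odd (index u LD) then [::] else arcD u).
  have -> : uniq (flatten (map R LC)) = uniq (flatten (map R1 LC) ++ flatten (map R2 LC) ++ flatten (map P LC)).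
    apply: perm_uniq; apply/seq.permP => a; rewrite !count_cat !count_flatten !sumnE !big_map -!big_split /=.
    apply: eq_bigr => u _; rewrite /= !count_cat.
    move: (count a (if _ then arcC u else _)) (count a (if _ then _ else arcD u)).
    by move: (nat_of_bool (a (x u))) (nat_of_bool (a (y u))) (count a (P u)); clear; lia.
  have sub1 : {subset flatten (map R1 LC) <= C}.
    move=> z /flatten_mapP [u uL]; rewrite (perm_mem hC.1) => zu.
    apply/flatten_mapP; exists u => //; move: zu; rewrite /R1 !inE.
    by case: ifP => //= _; rewrite orbF => ->.
  have sub2 z : z \in flatten (map R2 LC) -> (z \in D) && (z \notin C).
    case/flatten_mapP=> u uL zu; apply/andP; split.
      rewrite (perm_mem hD.1); apply/flatten_mapP; exists u; rewrite -?mLCD //.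
      by move: zu; rewrite /R2 !inE; case: ifP => //= _; rewrite orbF => ->.
    move: zu; rewrite /R2 inE => /orP [/eqP ->|]; first exact: yC.
    by case: ifP => // /negbT ou; apply: arcDC; rewrite -?mLCD.
  have usub (G : K -> seq T) (h : K -> T) (b : pred K) L E :
      uniq E -> perm_eq E (flatten [seq h u :: G u | u <- L]) ->
      uniq (flatten [seq h u :: (if b u then G u else [::]) | u <- L]).
    move=> uE pE; apply: subseq_uniq (_ : uniq (flatten [seq h u :: G u | u <- L])); last first.
      by rewrite -(perm_uniq pE).
    elim: L {pE} => //= u L IH; rewrite eqxx; apply: cat_subseq => //.
    by case: ifP => // _; apply: sub0seq.
  rewrite !cat_uniq uP andbT.
  have -> : uniq (flatten (map R1 LC)) by apply: usub uC hC.1.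
  have -> : uniq (flatten (map R2 LC)).
    have -> : uniq (flatten (map R2 LC)) = uniq (flatten (map R2 LD)).
      by apply: perm_uniq; apply: perm_flatten; apply: perm_map.
    have := usub _ _ (fun u => ~~ odd (index u LD)) _ _ uD hD.1.
    by congr (uniq (flatten _)); apply: eq_map => u; rewrite /R2; case: (odd _).
  have Pnot z : z \in flatten (map P LC) -> (z \notin C) && (z \notin D).
    by case/flatten_mapP=> u uL zu; apply: PC zu.
  rewrite /=; apply/andP; split; apply/hasPn => z.
    rewrite mem_cat => /orP [/sub2/andP [_ zC]|/Pnot /andP [zC _]];
    by apply: contra zC; apply: sub1.
  by move=> /Pnot /andP [_ zD]; apply: contra zD => /sub2 /andP [].
- apply: cycle_flatten => // u /sin uL; rewrite /blk.
  rewrite rcons_cat rcons_cons -cat_rcons cat_path last_rcons oarcP //=.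
  rewrite rcons_cat rcons_cons -cat_rcons cat_path last_rcons hP ?oin //=.
  rewrite rcons_cat rcons_cons -cat_rcons cat_path last_rcons iarcP ?oin //=.
  by rewrite -path_rev_sym hP // /g iin // oin.
- rewrite (perm_size permZ) size_flatten /shape -map_comp sumnE big_map.
  apply: eq_bigr => u _; rewrite /R /= !size_cat /half_weight !(fun_if size) /=.
  by rewrite !addnA.
Qed.

End HalfTour.

Lemma index_mid (A : eqType) (s1 s2 : seq A) z :
  uniq (s1 ++ z :: s2) -> index z (s1 ++ z :: s2) = size s1.
Proof.
rewrite cat_uniq /= negb_or => /and3P [_ /andP [zs1 _] _].
by rewrite index_cat (negbTE zs1) /= eqxx addn0.
Qed.

(** Induction on [L]: the first attachment splits [s], and the stretch before the next one, called
    [pre] by the induction hypothesis, becomes its arc. *)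
Lemma cut_seq (A : eqType) (x : K -> A) L (s : seq A) :
  uniq s -> {in L, forall u, x u \in s} -> sorted ltn [seq index (x u) s | u <- L] ->
  exists pre, exists arc : K -> seq A, s = pre ++ flatten [seq x u :: arc u | u <- L].
Proof.
elim: L s => [|u L IH] s us xs srt; first by exists s, (fun=> [::]); rewrite cats0.
have xu := xs u (mem_head u L); case/splitPr: xu us xs srt => p s' us xs srt.
have idx v : v \in L -> (x v \in s') && (index (x v) (p ++ x u :: s') == (size p + (index (x v) s').+1)%N).
  move=> vL; have := xs v; rewrite inE vL orbT => /(_ isT) xv.
  have : (size p < index (x v) (p ++ x u :: s'))%N.
    rewrite -(index_mid us); move: srt; rewrite /= path_sortedE; last exact: ltn_trans.
    by case/andP=> /allP /(_ (index (x v) (p ++ x u :: s'))) H _; apply: H; apply: map_f.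
  rewrite !index_cat; case: ifP => [xp|xp].
    by move=> h; have := xp; rewrite -index_mem; lia.
  rewrite /=; case: (eqVneq (x u) (x v)) => [_|ne] h; first lia.
  rewrite eqxx andbT; move: xv; rewrite mem_cat xp /= inE eq_sym (negbTE ne).
  by [].
have us' : uniq s' by move: us; rewrite cat_uniq /= => /and3P [_ _ /andP[]].
have uL : uniq (u :: L).
  by have := sorted_uniq ltn_trans ltnn srt; apply: map_uniq.
have [||pre [arc es']] := IH s' us'.
- by move=> v /idx /andP [].
- have : sorted ltn [seq index (x v) (p ++ x u :: s') | v <- L] := path_sorted srt.
  have -> : [seq index (x v) (p ++ x u :: s') | v <- L] =
      [seq (size p + n.+1)%N | n <- [seq index (x v) s' | v <- L]].
    by rewrite -map_comp; apply/eq_in_map => v /idx /andP [_ /eqP].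
  by rewrite sorted_map; apply: sub_sorted => a b /=; lia.
exists p, (fun v => if v == u then pre else arc v); rewrite /= eqxx {1}es'.
congr (p ++ _ :: _ ++ flatten _); apply/eq_in_map => v vL.
by case: eqP vL uL => // -> /= ->.
Qed.

Lemma cycle_flatten_next (x : K -> T) (A : K -> seq T) L :
  uniq L -> path.cycle e (flatten [seq x u :: A u | u <- L]) ->
  {in L, forall u, path e (x u) (rcons (A u) (x (next L u)))}.
Proof.
move=> uL cyc u uin; have [i L' eL] := rot_to uin.
have {cyc} : path.cycle e (flatten [seq x u :: A u | u <- rot i L]).
  by rewrite /rot map_cat flatten_cat -rot_size_cat rot_cycle -flatten_cat -map_cat cat_take_drop.
rewrite -(next_rot i uL) eL /=.
case: L' eL => [|v L'] eL /=; first by rewrite cats0 eqxx.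
by rewrite eqxx rcons_cat rcons_cons -cat_rcons cat_path => /andP [].
Qed.

(** The stretch of [C] before the first attachment is appended to the last arc, which therefore
    wraps around. The second conclusion covers the other arcs only; the inner ones are among them,
    since they start at even positions of a list of even length. *)
Lemma arcs_exist (x : K -> T) L (C : seq T) :
  uniq C -> path.cycle e C -> 0 < size L -> {in L, forall u, x u \in C} ->
  sorted ltn [seq index (x u) C | u <- L] ->
  exists2 arc : K -> seq T, arcs_of C x L arc &
    forall L1 u v L2, L = L1 ++ u :: v :: L2 -> {in arc u, forall z,
      (z \in C) && (index (x u) C < index z C < index (x v) C)}.
Proof.
move=> uC cC L0 xC srt; have [pre [arc eC]] := cut_seq uC xC srt.
have uL : uniq L by have := sorted_uniq ltn_trans ltnn srt; apply: map_uniq.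
case/lastP: L L0 uL xC srt eC => // L l _ uL xC srt eC.
pose arc' u := if u == l then arc l ++ pre else arc u.
have lL : l \notin L by move: uL; rewrite rcons_uniq => /andP [].
have eC' : flatten [seq x u :: arc' u | u <- rcons L l] =
    flatten [seq x u :: arc u | u <- rcons L l] ++ pre.
  rewrite !map_rcons -!cats1 !flatten_cat /= !cats0 /arc' eqxx -catA; congr (_ ++ _).
  congr flatten; apply/eq_in_map => v vL; case: eqP vL lL => // -> vL.
  by rewrite vL.
exists arc'; first split.
- by rewrite eC' [in X in perm_eq X]eC perm_catC.
- by apply: cycle_flatten_next => //; rewrite eC' -rot_size_cat rot_cycle -eC.
- move=> L1 u v L2 eL z.
  have -> : arc' u = arc u.
    rewrite /arc'; case: eqP => // eul.
    have : uniq (L1 ++ u :: v :: L2) by rewrite -eL.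
    have : last u (L1 ++ u :: v :: L2) = l by rewrite -eL last_rcons.
    rewrite last_cat /= => lst; rewrite cat_uniq => /and3P [_ _] /=.
    by rewrite inE negb_or eul -lst; have := mem_last v L2; rewrite inE => /orP [/eqP->|->]; rewrite ?eqxx ?andbF.
  have [W [B eC2]] : exists W, exists B, C = W ++ x u :: arc u ++ x v :: B.
    exists (pre ++ flatten [seq x w :: arc w | w <- L1]).
    exists (arc v ++ flatten [seq x w :: arc w | w <- L2]).
    by rewrite [LHS]eC eL map_cat flatten_cat /= -!catA.
  move=> zu; case/splitPr: zu eC2 => a1 a2 eC2.
  have h1 : index (x u) C = size W by rewrite eC2 index_mid // -eC2.
  have h2 : index z C = size (W ++ x u :: a1).
    have e2 : C = (W ++ x u :: a1) ++ z :: a2 ++ x v :: B by rewrite eC2 /= -!catA /= -?catA.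
    by rewrite e2 index_mid // -e2.
  have h3 : index (x v) C = size (W ++ x u :: a1 ++ z :: a2).
    have e2 : C = (W ++ x u :: a1 ++ z :: a2) ++ x v :: B by rewrite eC2 /= -!catA /= -?catA.
    by rewrite e2 index_mid // -e2.
  rewrite h1 h2 h3 eC2 mem_cat inE !mem_cat inE eqxx !orbT /=.
  by rewrite !size_cat /= !size_cat /=; lia.
Qed.

Variables (C D : seq T) (x y : K -> T) (P : K -> seq T).
Hypothesis uC : uniq C.
Hypothesis uD : uniq D.
Hypothesis cC : path.cycle e C.
Hypothesis cD : path.cycle e D.
Hypothesis maxC : forall Z, uniq Z -> path.cycle e Z -> size Z <= size C.
Hypothesis sizeD : size D = size C.
Variables (LC LD : seq K).
Hypothesis eLCD : perm_eq LC LD.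
Hypothesis xC : {in LC, forall u, (x u \in C) && (x u \notin D)}.
Hypothesis yD : {in LC, forall u, (y u \in D) && (y u \notin C)}.
Hypothesis hP : {in LC, forall u, path e (x u) (rcons (P u) (y u))}.
Hypothesis PC : {in LC, forall u, {in P u, forall z, (z \notin C) && (z \notin D)}}.
Hypothesis uP : uniq (flatten (map P LC)).
Hypothesis srtC : sorted ltn [seq index (x u) C | u <- LC].
Hypothesis srtD : sorted ltn [seq index (y u) D | u <- LD].
Hypothesis innerC : forall L1 u v L2, LC = L1 ++ u :: v :: L2 -> ~~ odd (size L1) ->
  {in C, forall z, index (x u) C < index z C < index (x v) C -> z \notin D}.
Hypothesis innerD : forall L1 u v L2, LD = L1 ++ u :: v :: L2 -> ~~ odd (size L1) ->
  {in D, forall z, index (y u) D < index z D < index (y v) D -> z \notin C}.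

Lemma even_split (L : seq K) u : uniq L -> ~~ odd (size L) -> u \in L -> ~~ odd (index u L) ->
  exists L1, exists v, exists L2, L = L1 ++ u :: v :: L2 /\ ~~ odd (size L1).
Proof.
move=> uL sL uin; case/splitPr: uin uL sL => L1 L2 uL sL.
rewrite index_mid // => o1; case: L2 uL sL => [|v L2] uL sL; last by exists L1, v, L2.
by move: sL; rewrite size_cat oddD /= (negbTE o1).
Qed.

(* The two tours together cover both cycles, and each path twice. *)
Lemma no_good_swap : ~~ odd (size LC) -> good_swap LC LD -> False.
Proof.
move=> evenC /andP [t1 t2].
have C0 : 0 < size LC by move: t1; rewrite /single_tour; case: LC.
have sCD := perm_size eLCD.
have uLC : uniq LC by have := sorted_uniq ltn_trans ltnn srtC; apply: map_uniq.
have uLD : uniq LD by rewrite -(perm_uniq eLCD).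
have mLCD := perm_mem eLCD.
have [|arcC hC iC] := arcs_exist uC cC C0 _ srtC; first by move=> u /xC /andP [].
have [||arcD hD iD] := arcs_exist uD cD _ _ srtD; first by rewrite -sCD.
  by move=> u; rewrite -mLCD => /yD /andP [].
have [||Z1 [uZ1 cZ1 sZ1]] := half_tour eLCD uLC uC uD hC hD hP PC uP _ _ t1.
- by move=> u /yD /andP [].
- move=> u uL ou; have [|L1 [v [L2 [eL oL]]]] := even_split uLD _ uL ou; first by rewrite -sCD.
  by move=> z /(iD _ _ _ _ eL) /andP [zD zi]; apply: innerD eL oL _ zD zi.
(* For the second tour the cycles change roles and the paths are reversed. *)
have [||||||Z2 [uZ2 cZ2 sZ2]] := @half_tour D C y x (rev \o P) LD LC arcD arcC _ uLD uD uC hD hC _ _ _ _ _ t2.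
- by rewrite perm_sym.
- by move=> u; rewrite -mLCD => uL; rewrite /= -path_rev_sym; apply: hP.
- by move=> u; rewrite -mLCD => uL z; rewrite /= mem_rev andbC; apply: PC.
- have -> : uniq (flatten (map (rev \o P) LD)) = uniq (flatten (map P LC)); last by [].
  apply: perm_uniq; apply: perm_trans (_ : perm_eq _ (flatten (map P LD))) _.
    apply/seq.permP => a; rewrite !count_flatten -!map_comp; congr sumn.
    by apply: eq_map => u /=; rewrite count_rev.
  by apply: perm_flatten; apply: perm_map; rewrite perm_sym.
- by move=> u; rewrite -mLCD => /xC /andP [].
- move=> u uL ou; have [L1 [v [L2 [eL oL]]]] := even_split uLC evenC uL ou.
  by move=> z /(iC _ _ _ _ eL) /andP [zC zi]; apply: innerC eL oL _ zC zi.
have sum1 : size C = \sum_(u <- LC) (size (arcC u)).+1.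
  by rewrite (perm_size hC.1) size_flatten /shape -map_comp sumnE big_map.
have sum2 : size D = \sum_(u <- LC) (size (arcD u)).+1.
  by rewrite (perm_size hD.1) size_flatten /shape -map_comp sumnE big_map (perm_big _ eLCD).
(* Each label contributes four attachments to the two tours and only two to the two cycles: a gain
   of at least 2. *)
have : size C + size D + 2 * size LC <= size Z1 + size Z2.
  rewrite sZ1 sZ2 -(perm_big _ eLCD) sum1 sum2 -sum1_size big_distrr /= -!big_split /=.
  rewrite leq_sum // => u _; rewrite /half_weight /= size_rev.
  move: (size (arcC u)) (size (arcD u)) (size (P u)) => a b c.
  by case: (odd _); case: (odd _); rewrite ?addn0; clear; lia.
have := maxC uZ1 cZ1; have := maxC uZ2 cZ2; rewrite sizeD.
by move: (size C) (size Z1) (size Z2) (size LC) C0; clear; lia.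
Qed.

End Swap.

(** * The orders of a hexagon configuration *)

(* The forced orders in a hexagon configuration (see [hexagon]), up to symmetry: on
   I_0 one meets J_0, J_1, J_2, J_3 in this order, on J_0 one meets I_0 and then the
   other I_i in the order [sigma], and all the other segments reverse these orders,
   except for the place of J_0 or I_0; [tau] is the order of I_1, I_2, I_3 on the
   cycle after I_0.  The label (i, j) stands for the path between I_i and J_j. *)
Definition rowI (b : bool) (i : nat) : seq nat :=
  if i is 0 then iota 0 4 else
  let s := [seq j <- rev (iota 1 3) | j != i] in if b then 0 :: s else rcons s 0.

Definition rowJ (sigma : seq nat) (j : nat) : seq nat :=
  if j is 0 then 0 :: sigma else rcons [seq i <- rev sigma | i != j] 0.

Definition orderC (b : bool) (tau : seq nat) : seq (nat * nat) :=
  flatten [seq [seq (i, j) | j <- rowI b i] | i <- 0 :: tau].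

Definition orderD (sigma tau : seq nat) : seq (nat * nat) :=
  flatten [seq [seq (i, j) | i <- rowJ sigma j] | j <- 0 :: tau].

(* Hexagons and octagons found by computer search. *)
Definition swap_candidates : seq (seq (nat * nat)) :=
  [:: [:: (0,0); (0,1); (1,0); (1,3); (2,1); (2,3)];
      [:: (0,0); (0,2); (1,2); (1,3); (2,0); (2,3)];
      [:: (0,0); (0,3); (1,2); (1,3); (3,0); (3,2)];
      [:: (0,0); (0,2); (2,0); (2,1); (3,1); (3,2)];
      [:: (0,0); (0,3); (2,1); (2,3); (3,0); (3,1)];
      [:: (0,0); (0,1); (1,0); (1,2); (3,1); (3,2)];
      [:: (0,1); (0,2); (2,0); (2,1); (3,0); (3,2)];
      [:: (0,2); (0,3); (1,0); (1,2); (2,0); (2,3)];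
      [:: (0,0); (0,1); (1,2); (1,3); (2,1); (2,3); (3,0); (3,2)];
      [:: (0,2); (0,3); (1,0); (1,2); (2,1); (2,3); (3,0); (3,1)];
      [:: (0,2); (0,3); (1,2); (1,3); (2,0); (2,1); (3,0); (3,1)]].

(** When [f] gives the segment of an attachment, this says that each inner arc stays inside one
    segment. *)
Fixpoint paired (A : Type) (B : eqType) (f : A -> B) (L : seq A) : bool :=
  match L with
  | u :: v :: L' => (f u == f v) && paired f L'
  | [::] => true
  | _ => false
  end.

(** The edges of the configuration: a hexagon on the six segments other than I_0 and J_0, and all
    edges at I_0 or J_0. *)
Definition hexagon_label (u : nat * nat) :=
  [&& u.1 < 4, u.2 < 4 & [|| u.1 == 0, u.2 == 0 | u.1 != u.2]].

Definition swappable LC LD (U : seq (nat * nat)) : bool :=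
  let LC' := [seq l <- LC | l \in U] in
  let LD' := [seq l <- LD | l \in U] in
  [&& all hexagon_label LC', paired fst LC', paired snd LD', perm_eq LC' LD' & good_swap LC' LD'].

(** There are 2 * 6^3 = 432 patterns of orders, each settled by evaluating the candidates. *)
Lemma all_orders_swappable :
  all (fun b => all (fun tau => all (fun sigma => all (fun tau' =>
      has (swappable (orderC b tau) (orderD sigma tau')) swap_candidates)
     (permutations (iota 1 3))) (permutations (iota 1 3))) (permutations (iota 1 3)))
    [:: true; false].
Proof. by vm_compute. Qed.

(** * Longest cycles joined by disjoint paths *)

Lemma paired_even (A : Type) (B : eqType) (f : A -> B) L : paired f L -> ~~ odd (size L).
Proof.
have [n] := ubnP (size L); elim: n L => // n IH [|u [|v L]] //= ltn /andP [_ /IH].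
by rewrite negbK; apply; lia.
Qed.

Lemma paired_split (A : Type) (B : eqType) (f : A -> B) L1 u v L2 :
  paired f (L1 ++ u :: v :: L2) -> ~~ odd (size L1) -> f u = f v.
Proof.
have [n] := ubnP (size L1); elim: n L1 => // n IH [|w [|w' L1]] //=.
  by move=> _ /andP [/eqP].
by move=> lt /andP [_ p]; rewrite negbK => o; apply: IH p o; lia.
Qed.

Lemma paired_sub (A : Type) (B B' : eqType) (Q : pred A) (f : A -> B) (f' : A -> B') L :
  (forall u v, Q u -> Q v -> f u = f v -> f' u = f' v) -> all Q L -> paired f L -> paired f' L.
Proof.
move=> H; have [n] := ubnP (size L); elim: n L => // n IH [|u [|v L]] //= lt.
case/and3P=> Qu Qv QL /andP [/eqP fuv /IH ->] //; last exact: ltnW.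
by rewrite (H _ _ Qu Qv fuv) eqxx.
Qed.

Lemma index_rot (A : eqType) (s : seq A) n z : uniq s -> n <= size s -> z \in s ->
  index z (rot n s) = if index z s < n then index z s + (size s - n) else index z s - n.
Proof.
move=> us ns zs; have szt : size (take n s) = n by apply: size_takel.
have es : index z s = if z \in take n s then index z (take n s) else n + index z (drop n s).
  by rewrite -{1}(cat_take_drop n s) index_cat szt.
move: us zs; rewrite -{1 2}(cat_take_drop n s) cat_uniq mem_cat => /and3P [_ /hasPn dis _].
rewrite {}es /rot index_cat size_drop; case zt: (z \in take n s); case zd: (z \in drop n s) => //= _.
- by have := dis _ zd; rewrite /= zt.
- by have := zt; rewrite -index_mem szt => ->; rewrite addnC.
- by rewrite ltnNge leq_addr addKn.
Qed.

Lemma index_rev (A : eqType) (s : seq A) z : uniq s -> z \in s ->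
  index z (rev s) = size s - (index z s).+1.
Proof.
move=> us zs; case/splitPr: zs us => s1 s2 us.
rewrite index_mid // rev_cat rev_cons cat_rcons index_mid ?size_rev ?size_cat /=; first lia.
by rewrite -cat_rcons -rev_cons -rev_cat rev_uniq.
Qed.

Section Crossing.
Variables (T : finType) (e : rel T) (K : finType).
Hypothesis e_sym : symmetric e.

(* Two longest cycles with disjoint paths between them, labelled by [K].  The
   functions [a] and [b] number the segments into which the two cycles are cut:
   no vertex of the other cycle lies between two attachments to a segment. *)
Record crossing (C D : seq T) (x y : K -> T) (P : K -> seq T) (a b : K -> nat) : Prop :=
  Crossing {
    cr_uC : uniq C; cr_uD : uniq D;
    cr_cC : path.cycle e C; cr_cD : path.cycle e D;
    cr_max : forall Z, uniq Z -> path.cycle e Z -> size Z <= size C;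
    cr_size : size D = size C;
    cr_x : forall u, (x u \in C) && (x u \notin D);
    cr_y : forall u, (y u \in D) && (y u \notin C);
    cr_P : forall u, path e (x u) (rcons (P u) (y u));
    cr_PCD : forall u, {in P u, forall z, (z \notin C) && (z \notin D)};
    cr_uP : forall L, uniq L -> uniq (flatten (map P L));
    cr_xI : injective x; cr_yI : injective y;
    cr_monoC : forall u v, index (x u) C < index (x v) C -> a u <= a v;
    cr_monoD : forall u v, index (y u) D < index (y v) D -> b u <= b v;
    cr_innC : forall u v, a u = a v -> {in C, forall z,
      index (x u) C < index z C < index (x v) C -> z \notin D};
    cr_innD : forall u v, b u = b v -> {in D, forall z,
      index (y u) D < index z D < index (y v) D -> z \notin C} }.

Lemma crossing_swap C D x y P a b :
  crossing C D x y P a b -> crossing D C y x (rev \o P) b a.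
Proof.
case=> uC uD cC cD mx sz xC yD hP PCD uP xI yI mC mD iC iD; split=> //.
- by rewrite sz.
- by move=> u /=; rewrite -path_rev_sym.
- by move=> u z; rewrite /= mem_rev andbC; apply: PCD.
- move=> L uL; have := uP L uL; congr is_true; apply: perm_uniq; apply/seq.permP => f.
  rewrite !count_flatten -!map_comp; congr sumn.
  by apply: eq_map => u /=; rewrite count_rev.
Qed.

(** The segments of the reversed cycle are numbered from the other end. *)
Lemma crossing_rev C D x y P a b M : (forall u, a u <= M) ->
  crossing C D x y P a b -> crossing (rev C) D x y P (fun u => M - a u) b.
Proof.
move=> aM [] uC uD cC cD mx sz xC yD hP PCD uP xI yI mC mD iC iD.
have xin u : x u \in C by case/andP: (xC u).
split=> //; rewrite ?rev_uniq ?size_rev //.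
- rewrite rev_cycle; have : path.cycle e C by []. 
  by congr is_true; apply: eq_cycle => u v; rewrite e_sym.
- by move=> u; rewrite mem_rev.
- by move=> u; rewrite mem_rev.
- by move=> u z; rewrite mem_rev; apply: PCD.
- move=> u v; rewrite !index_rev // => lt.
  by have := mC v u; move: (xin u) (xin v); rewrite -!index_mem; lia.
- move=> u v eq z; rewrite mem_rev => zC; rewrite !index_rev // => lt.
  apply: (iC v u) => //; first by have := aM u; have := aM v; lia.
  by move: (xin u) (xin v) zC; rewrite -!index_mem; lia.
- by move=> u v eq z zD lt; rewrite mem_rev; apply: iD eq _ zD lt.
Qed.

(** The list is rotated so that the segment of [u0] comes first; the segments before it move to the
    end, hence the shift of their numbers by [M]. As the cut falls between segments, the order
    within a segment is unchanged. *)
Lemma crossing_rot C D x y P a b u0 M : (forall u, a u < M) ->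
  crossing C D x y P a b -> exists n, let C' := rot n C in
  let a' := fun u => if a u < a u0 then a u + M else a u in
  [/\ crossing C' D x y P a' b, forall u, a' u0 <= a' u &
   forall u v, a u = a v -> (index (x u) C' < index (x v) C') = (index (x u) C < index (x v) C)].
Proof.
move=> aM [] uC uD cC cD mx sz xC yD hP PCD uP xI yI mC mD iC iD.
have xin u : x u \in C by case/andP: (xC u).
(* The position just after the last attachment to a segment numbered below that of [u0], or 0 if
   there is none. *)
pose n := \max_(u | a u < a u0) (index (x u) C).+1.
have nP u : (index (x u) C < n) = (a u < a u0).
  apply/idP/idP => [|lt]; last exact: (@leq_bigmax_cond _ _ (fun u => (index (x u) C).+1)).
  rewrite ltnNge; apply: contraLR; rewrite -leqNgt => le; rewrite negbK.
  apply/bigmax_leqP => v lt; rewrite ltnNge leq_eqVlt negb_or; apply/andP; split.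
    apply/eqP => /(congr1 (nth (x u) C)); rewrite !nth_index // => /xI euv.
    by move: lt; rewrite -euv ltnNge le.
  by apply/negP => /mC; rewrite leqNgt (leq_trans lt le).
have nC : n <= size C by apply/bigmax_leqP => v _; rewrite index_mem.
exists n => C' a'; have ixE u : index (x u) C' = _ := index_rot uC nC (xin u).
split; last first.
- move=> u v euv; rewrite !ixE !nP euv; case: ifP => lt; first by rewrite ltn_add2r.
  have := nP u; have := nP v; rewrite euv lt; lia.
- by move=> u; rewrite /a' ltnn; case: ifP => lt; [have := aM u0|]; lia.
split=> //; rewrite ?rot_uniq ?rot_cycle ?size_rot //.
- by move=> u; rewrite mem_rot.
- by move=> u; rewrite mem_rot.
- by move=> u z; rewrite mem_rot; apply: PCD.
- move=> u v; rewrite !ixE /a' -!nP.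
  have := mC u v; have := aM u; have := aM v; have := nP u; have := nP v.
  by move: (xin u) (xin v); rewrite -!index_mem; do 2 case: ifP; lia.
- move=> u v euv z; rewrite mem_rot => zC; rewrite !ixE index_rot //.
  have euv' : a u = a v by move: euv; rewrite /a'; have := aM u; have := aM v; do 2 case: ifP; lia.
  move=> lt; apply: (iC u v) => //; move: lt; rewrite !nP -euv'.
  have := nP u; have := nP v; rewrite -euv'; move: (xin u) (xin v) zC; rewrite -!index_mem.
  by do 2 case: ifP; lia.
- by move=> u v eq z zD lt; rewrite mem_rot; apply: iD eq _ zD lt.
Qed.

Section Rules.
Variables (C D : seq T) (x y : K -> T) (P : K -> seq T) (a b : K -> nat).
Hypothesis cr : crossing C D x y P a b.

Let p u := index (x u) C.
Let q u := index (y u) D.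

(** The labels in [K'] may be numbers, on which [good_swap] can be evaluated; [paired] ensures that
    the inner arcs avoid the other cycle. *)
Lemma crossing_no_good_swap (K' : eqType) (lab : K' -> K) (LC LD : seq K') :
  {in LC &, injective lab} -> perm_eq LC LD ->
  sorted ltn [seq p (lab u) | u <- LC] -> sorted ltn [seq q (lab u) | u <- LD] ->
  paired (a \o lab) LC -> paired (b \o lab) LD -> good_swap LC LD -> False.
Proof.
move=> inj eLCD sC sD pC pD; have [uC uD cC cD mx sz xC yD hP PCD uP _ _ _ _ iC iD] := cr.
apply: (@no_good_swap _ _ e_sym _ C D (x \o lab) (y \o lab) (P \o lab)) => //.
- by move=> u _; apply: xC.
- by move=> u _; apply: yD.
- by move=> u _; apply: hP.
- by move=> u _; apply: PCD.
- rewrite map_comp; apply: uP; rewrite map_inj_in_uniq //.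
  by have := sorted_uniq ltn_trans ltnn sC; apply: map_uniq.
- move=> L1 u v L2 eL o; apply: iC; have pL := pC; rewrite eL in pL; exact: (paired_split pL o).
- move=> L1 u v L2 eL o; apply: iD; have pL := pD; rewrite eL in pL; exact: (paired_split pL o).
- exact: paired_even pC.
Qed.

Lemma posC_inj : injective p.
Proof.
have [_ _ _ _ _ _ xC _ _ _ _ xI _ _ _ _ _] := cr.
move=> u v; rewrite /p => /(congr1 (nth (x u) C)).
have [xu _] := andP (xC u); have [xv _] := andP (xC v).
by rewrite !nth_index // => /xI.
Qed.

Lemma posC_seg u v : a u < a v -> p u < p v.
Proof.
move=> lt; rewrite ltn_neqAle leqNgt; apply/andP; split.
  by apply: contraTneq lt => /posC_inj ->; rewrite ltnn.
by apply: contraTN lt => /(cr_monoC cr); rewrite -leqNgt.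
Qed.

End Rules.

Lemma posD_inj C D x y P a b : crossing C D x y P a b ->
  injective (fun u => index (y u) D).
Proof. by move/crossing_swap; apply: posC_inj. Qed.

Lemma posD_seg C D x y P a b : crossing C D x y P a b ->
  forall u v, b u < b v -> index (y u) D < index (y v) D.
Proof. by move/crossing_swap; apply: posC_seg. Qed.

(** Two paths between the same two segments would give a good swap, whatever the order of their ends
    on [D]. Hence the graph on the segments has no double edges. *)
Lemma crossing_simple C D x y P a b : crossing C D x y P a b ->
  forall u v, a u = a v -> b u = b v -> u = v.
Proof.
move=> cr u v; wlog lt : u v / index (x u) C < index (x v) C.
  move=> H au bu; have [lt|lt|eq] := ltngtP (index (x u) C) (index (x v) C).
  - exact: H.
  - by apply/esym/H.
  - exact: posC_inj cr _ _ eq.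
move=> au bu; have nuv : u != v by apply: contraTneq lt => ->; rewrite ltnn.
pose lab (n : nat) := if n is 0 then u else v.
have inj : {in [:: 0; 1] &, injective lab}.
  move=> i j; rewrite !inE => /orP [] /eqP -> /orP [] /eqP -> //= h.
    by rewrite h eqxx in nuv.
  by rewrite h eqxx in nuv.
have [ltq|ltq|/(posD_inj cr) //] := ltngtP (index (y u) D) (index (y v) D).
- case: (crossing_no_good_swap cr inj (_ : perm_eq _ [:: 0; 1])) => //=.
  + by rewrite lt.
  + by rewrite ltq.
  + by rewrite au eqxx.
  + by rewrite bu eqxx.
- case: (crossing_no_good_swap cr inj (_ : perm_eq _ [:: 1; 0])) => //=.
  + by rewrite lt.
  + by rewrite ltq.
  + by rewrite au eqxx.
  + by rewrite bu eqxx.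
Qed.

Lemma sorted_blocks (f : nat -> nat -> nat) (r : nat -> seq nat) (g : nat -> nat) (tau : seq nat) :
  sorted ltn (map g tau) ->
  {in tau, forall i, sorted ltn [seq f i j | j <- r i]} ->
  {in tau &, forall i i', g i < g i' -> {in r i & r i', forall j j', f i j < f i' j'}} ->
  sorted ltn (flatten [seq [seq f i j | j <- r i] | i <- tau]).
Proof.
rewrite !sorted_pairwise; try exact: ltn_trans.
elim: tau => //= i tau IH /andP [h1 h2] hs hb; rewrite pairwise_cat -sorted_pairwise; last exact: ltn_trans.
rewrite hs ?mem_head // IH ?andbT //=.
- apply/allrelP => m n /mapP [j jr ->] /flattenP [s /mapP [i' i't ->] /mapP [j' j'r ->]].
  apply: hb => //; rewrite ?inE ?eqxx ?i't ?orbT //.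
  by apply: (allP h1); apply: map_f.
- by move=> i' i't; apply: hs; rewrite inE i't orbT.
- by move=> i1 i2 h h'; apply: hb; rewrite inE ?h ?h' orbT.
Qed.

(* Two segments of [C] joined to the same two segments of [D] cannot see them in
   the same order if those two also see the segments of [C] in the same order. *)
Lemma crossing_no_parallel C D x y P a b : crossing C D x y P a b ->
  forall u u' v v' : K,
  a u = a u' -> a v = a v' -> b u = b v -> b u' = b v' -> a u != a v -> b u != b u' ->
  (index (x u) C < index (x u') C) = (index (x v) C < index (x v') C) ->
  (index (y u) D < index (y v) D) = (index (y u') D < index (y v') D) -> False.
Proof.
move=> cr; set p := fun u => index (x u) C; set q := fun u => index (y u) D.
move=> u u' v v'; wlog la : u u' v v' / a u < a v.
  move=> H au av bu bv nab nbb; have [lt|lt|eq] := ltngtP (a u) (a v).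
  - exact: H.
  - move=> hp hq; apply: (H v v' u u' lt av au (esym bu) (esym bv) _ _ (esym hp)).
    + by rewrite eq_sym.
    + by rewrite -bu -bv.
    have fl w w' : a w != a w' -> (q w' < q w) = ~~ (q w < q w').
      rewrite -leqNgt [in RHS]leq_eqVlt => nw; case: eqP => // /(posD_inj cr) eww.
      by rewrite eww eqxx in nw.
    transitivity (~~ (q u < q v)); first exact: fl.
    by rewrite /q hq; apply/esym/fl; rewrite -au -av.
  - by rewrite eq eqxx in nab.
wlog lb : u u' v v' la / b u < b u'.
  move=> H au av bu bv nab nbb; have [lt|lt|eq] := ltngtP (b u) (b u').
  - exact: H.
  - move=> hp hq; apply: (H u' u v' v _ lt (esym au) (esym av) bv bu _ _ _ (esym hq)).
    + by rewrite -au -av.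
    + by rewrite -au -av.
    + by rewrite eq_sym.
    have fl w w' : b w != b w' -> (p w' < p w) = ~~ (p w < p w').
      rewrite -leqNgt [in RHS]leq_eqVlt => nw; case: eqP => // /(posC_inj cr) eww.
      by rewrite eww eqxx in nw.
    transitivity (~~ (p u < p u')); first exact: fl.
    by rewrite /p hp; apply/esym/fl; rewrite -bu -bv.
  - by rewrite eq eqxx in nbb.
move=> au av bu bv nab nbb hp hq.
pose l (ij : nat * nat) := match ij with (0, 0) => u | (0, _) => u' | (_, 0) => v | _ => v' end.
pose r (c : bool) := if c then [:: 0; 1] else [:: 1; 0].
pose LC := flatten [seq [seq (i, j) | j <- r (p u < p u')] | i <- [:: 0; 1]].
pose LD := flatten [seq [seq (i, j) | i <- r (q u < q v)] | j <- [:: 0; 1]].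
have pn w w' : b w != b w' -> (p w < p w') = false -> p w' < p w.
  move=> nw h; case: (ltngtP (p w) (p w')) h => // /(posC_inj cr) eww _.
  by rewrite eww eqxx in nw.
have qn w w' : a w != a w' -> (q w < q w') = false -> q w' < q w.
  move=> nw h; case: (ltngtP (q w) (q w')) h => // /(posD_inj cr) eww _.
  by rewrite eww eqxx in nw.
have pC := posC_seg cr; have qD := posD_seg cr.
apply: (@crossing_no_good_swap C D x y P a b cr _ l LC LD).
- have nl w w' : a w != a w' -> w <> w' by move=> + eww; rewrite eww eqxx.
  have nl' w w' : b w != b w' -> w <> w' by move=> + eww; rewrite eww eqxx.
  have mem ij : ij \in LC -> [\/ ij = (0,0), ij = (0,1), ij = (1,0) | ij = (1,1)].
    by rewrite /LC; case: (p u < p u') => /=; rewrite !inE => /or4P [] /eqP ->;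
      [constructor 1|constructor 2|constructor 3|constructor 4|constructor 2|constructor 1|constructor 4|constructor 3].
  have nab' := nab; rewrite eq_sym in nab'; have nbb' := nbb; rewrite eq_sym in nbb'.
  by move=> w w' /mem [] -> /mem [] -> //= => [/nl'|/nl|/nl|/nl'|/nl|/nl|/nl|/nl|/nl'|/nl|/nl|/nl'];
    rewrite -?au -?av -?bu -?bv => /(_ _) h; case: h.
- by rewrite /LC /LD; case: (p u < p u'); case: (q u < q v).
- have h2 : p u' < p v by apply: pC; rewrite -au.
  have h3 : p u < p v' by apply: pC; rewrite -av.
  rewrite /LC; case E : (p u < p u'); have E' := esym hp; rewrite -/(p _) -/(p u') E in E'.
    by move: E E' h2; rewrite /p /= => -> -> ->.
  have f1 : p u' < p u by apply: pn.
  have f2 : p v' < p v by apply: pn; rewrite // -bv -bu.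
  by move: f1 f2 h3; rewrite /p /= => -> -> ->.
- have h2 : q v < q u' by apply: qD; rewrite -bu.
  have h3 : q u < q v' by apply: qD; rewrite -bv.
  rewrite /LD; case E : (q u < q v); have E' := esym hq; rewrite -/(q _) -/(q v) E in E'.
    by move: E E' h2; rewrite /q /= => -> -> ->.
  have f1 : q v < q u by apply: qn.
  have f2 : q v' < q u' by apply: qn; rewrite // -av -au.
  by move: f1 f2 h3; rewrite /q /= => -> -> ->.
- by rewrite /LC; case: (p u < p u'); rewrite /= au av !eqxx.
- by rewrite /LD; case: (q u < q v); rewrite /= bu bv !eqxx.
(* In each of the four possible orders the exchange along the 4-cycle succeeds both ways. *)
- by rewrite /LC /LD; case: (p u < p u'); case: (q u < q v); vm_compute.
Qed.

(** * Forced orders in a hexagon configuration *)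

Section Hexagon.
Variables (C D : seq T) (x y : K -> T) (P : K -> seq T) (a b : K -> nat) (lab : nat * nat -> K).
Let p u := index (x (lab u)) C.
Let q u := index (y (lab u)) D.

(* The segments I_0, .., I_3 of [C] and J_0, .., J_3 of [D], with I_i adjacent to J_j
   through [lab (i, j)] unless i = j > 0: a hexagon all of whose vertices are
   adjacent to one of the ends of the edge I_0 J_0. *)
Definition hexagon (b1 b2 b3 b4 : bool) :=
  [/\ {in hexagon_label &, forall u v, (a (lab u) == a (lab v)) = (u.1 == v.1)},
      {in hexagon_label &, forall u v, (b (lab u) == b (lab v)) = (u.2 == v.2)},
      {in iota 1 3, forall i, (p (0, 0) < p (0, i)) = b1 /\ (q (0, 0) < q (i, 0)) = b3} &
      {in iota 1 3 &, forall i j, i != j ->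
        (p (i, 0) < p (i, j)) = b2 /\ (q (0, j) < q (i, j)) = b4}].

Lemma sort3 (f : nat -> nat) : {in iota 1 3 &, injective f} ->
  exists2 s, s \in permutations (iota 1 3) & sorted ltn (map f s).
Proof.
move=> inj; exists (sort (relpre f leq) (iota 1 3)).
  by rewrite mem_permutations perm_sort.
rewrite ltn_sorted_uniq_leq; apply/andP; split.
  by rewrite map_inj_in_uniq ?sort_uniq // => u v; rewrite !mem_sort; apply: inj.
by rewrite sorted_map; apply: sort_sorted => u v /=; apply: leq_total.
Qed.

Hypothesis cr : crossing C D x y P a b.

(** On each J_j with j > 0, I_0 comes after the other I_i, so by [crossing_no_parallel] I_i sees the
    J_j in the order opposite to that on I_0. Likewise J_j reverses the order of the I_i on J_0,
    because [b2] places J_0 in the same way on all I_i. Only [b2], the order of the I_i on J_0 and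
    the orders of the segments on the two cycles remain free, and these are the cases of
    [all_orders_swappable]. *)
Lemma hexagon_absurd_sorted b2 : hexagon true b2 true false ->
  (forall u, a (lab (0, 0)) <= a u) -> (forall u, b (lab (0, 0)) <= b u) ->
  sorted ltn [seq p (0, j) | j <- iota 1 3] -> False.
Proof.
case=> ha hb h1 h2 mina minb srtJ.
have par u u' v v' := @crossing_no_parallel _ _ _ _ _ _ _ cr (lab u) (lab u') (lab v) (lab v').
have pinj := posC_inj cr; have qinj := posD_inj cr.
have lin i j : i \in 0 :: iota 1 3 -> j \in 0 :: iota 1 3 -> (i == 0) || (j == 0) || (i != j) ->
    hexagon_label (i, j).
  by rewrite !inE => /or4P [] /eqP -> /or4P [] /eqP ->.
have pneq u v : hexagon_label u -> hexagon_label v -> u != v -> lab u != lab v.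
  move=> hu hv; apply: contraNneq => euv; rewrite -pair_eqE /pair_eq /=.
  by rewrite -(ha _ _ hu hv) -(hb _ _ hu hv) euv !eqxx.
have i3 i : i \in iota 1 3 -> (i \in 0 :: iota 1 3) * (i != 0).
  by rewrite !inE => /or3P [] /eqP ->.
have pJ j j' : j \in iota 1 3 -> j' \in iota 1 3 -> j < j' -> p (0, j) < p (0, j').
  move: srtJ => /=; rewrite !andbT => /andP [p12 p23].
  rewrite !inE => /or3P [] /eqP -> /or3P [] /eqP -> // _.
  exact: ltn_trans p12 p23.
have rowrev i j j' : i \in iota 1 3 -> j \in iota 1 3 -> j' \in iota 1 3 ->
    i != j -> i != j' -> j < j' -> p (i, j') < p (i, j).
  move=> ii jj jj' nj nj' lt; rewrite ltnNge leq_eqVlt negb_or.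
  have l1 : hexagon_label (i, j) by apply: lin; rewrite ?i3 ?nj ?orbT.
  have l2 : hexagon_label (i, j') by apply: lin; rewrite ?i3 ?nj' ?orbT.
  have l3 : hexagon_label (0, j) by apply: lin => //; rewrite i3.
  have l4 : hexagon_label (0, j') by apply: lin => //; rewrite i3.
  apply/andP; split.
    apply: contraTneq lt => /pinj eqj; have := hb _ _ l1 l2; rewrite eqj eqxx /= => /esym/eqP ->.
    by rewrite ltnn.
  apply/negP => lt'; apply: (par (0, j) (0, j') (i, j) (i, j')).
  - by apply/eqP; rewrite ha.
  - by apply/eqP; rewrite ha.
  - by apply/eqP; rewrite hb.
  - by apply/eqP; rewrite hb.
  - by rewrite ha // eq_sym i3.
  - by rewrite hb //=; apply: contraTneq lt => ->; rewrite ltnn.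
  - by rewrite -/(p (0, j)) -/(p (0, j')) pJ //; apply/esym.
  - have [_ e1] := h2 i j ii jj nj; have [_ e2] := h2 i j' ii jj' nj'.
    by rewrite -/(q (0, j)) -/(q (0, j')) e1 e2.
have colrev i i' j : i \in iota 1 3 -> i' \in iota 1 3 -> j \in iota 1 3 ->
    i != j -> i' != j -> q (i, 0) < q (i', 0) -> q (i', j) < q (i, j).
  move=> ii ii' jj nj nj' lt; rewrite ltnNge leq_eqVlt negb_or.
  have l1 : hexagon_label (i, j) by apply: lin; rewrite ?i3 ?nj ?orbT.
  have l2 : hexagon_label (i', j) by apply: lin; rewrite ?i3 ?nj' ?orbT.
  have l3 : hexagon_label (i, 0) by apply: lin; rewrite ?orbT // i3.
  have l4 : hexagon_label (i', 0) by apply: lin; rewrite ?orbT // i3.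
  have nii : i != i' by apply: contraTneq lt => ->; rewrite ltnn.
  apply/andP; split.
    by apply: contraNneq nii => /qinj eqj; have := ha _ _ l1 l2; rewrite eqj eqxx /= => /esym.
  apply/negP => lt'; apply: (par (i, 0) (i, j) (i', 0) (i', j)).
  - by apply/eqP; rewrite ha.
  - by apply/eqP; rewrite ha.
  - by apply/eqP; rewrite hb.
  - by apply/eqP; rewrite hb.
  - by rewrite ha.
  - by rewrite hb // eq_sym i3.
  - have [e1 _] := h2 i j ii jj nj; have [e2 _] := h2 i' j ii' jj nj'.
    by rewrite -/(p (i, 0)) -/(p (i', 0)) e1 e2.
  - by rewrite -/(q (i, 0)) -/(q (i', 0)) lt; apply/esym.
have q0 i j : i \in iota 1 3 -> j \in iota 1 3 -> i != j -> q (i, j) < q (0, j).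
  move=> ii jj nj; have [_ e1] := h2 i j ii jj nj; rewrite ltn_neqAle leqNgt e1 andbT.
  apply/eqP => /qinj eqj; have l1 : hexagon_label (i, j) by apply: lin; rewrite ?i3 ?nj ?orbT.
  have l3 : hexagon_label (0, j) by apply: lin => //; rewrite i3.
  by have := ha _ _ l1 l3; rewrite eqj eqxx /= => /esym; rewrite (negbTE (i3 _ ii).2).
have p0 i j : i \in iota 1 3 -> j \in iota 1 3 -> i != j -> b2 = false -> p (i, j) < p (i, 0).
  move=> ii jj nj eb; have [e1 _] := h2 i j ii jj nj; rewrite ltn_neqAle leqNgt e1 eb andbT.
  apply/eqP => /pinj eqj; have l1 : hexagon_label (i, j) by apply: lin; rewrite ?i3 ?nj ?orbT.
  have l3 : hexagon_label (i, 0) by apply: lin; rewrite ?orbT // i3.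
  by have := hb _ _ l1 l3; rewrite eqj eqxx /= => /esym; rewrite (negbTE (i3 _ jj).2).
have l0 i : i \in 0 :: iota 1 3 -> hexagon_label (i, 0) by move=> ii; apply: lin; rewrite ?orbT.
have l0' i : i \in 0 :: iota 1 3 -> hexagon_label (0, i) by move=> ii; apply: lin.
(* [sg] orders the I_i on J_0, [ta] the segments I_i on [C], and [ta'] the segments J_j on [D]. *)
have [|sg sgin sgs] := @sort3 (fun i => q (i, 0)).
  move=> i i' /i3 [ii _] /i3 [ii' _] /qinj eqi; apply/eqP.
  by have := ha _ _ (l0 _ ii) (l0 _ ii'); rewrite eqi eqxx.
have [|ta tain tas] := @sort3 (fun i => a (lab (i, 0))).
  move=> i i' /i3 [ii _] /i3 [ii' _] eqi; apply/eqP.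
  by rewrite -(ha _ _ (l0 _ ii) (l0 _ ii')) eqi.
have [|ta' ta'in ta's] := @sort3 (fun j => b (lab (0, j))).
  move=> i i' /i3 [ii _] /i3 [ii' _] eqi; apply/eqP.
  by rewrite -(hb _ _ (l0' _ ii) (l0' _ ii')) eqi.
have b2in : b2 \in [:: true; false] by case: (b2).
have := all_orders_swappable => /allP /(_ _ b2in) /allP /(_ _ tain) /allP /(_ _ sgin) /allP /(_ _ ta'in).
case/hasP=> U _ /and5P [lU pC pD eCD gs].

have sub3 s i : s \in permutations (iota 1 3) -> i \in 0 :: s -> i \in 0 :: iota 1 3.
  by rewrite mem_permutations !inE => /perm_mem ->; rewrite !inE.
have lrow i j : i \in 0 :: iota 1 3 -> j \in rowI b2 i -> hexagon_label (i, j).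
  move=> ii; apply/allP: j; move: ii.
  by rewrite !inE => /or4P [] /eqP ->; case: (b2).
have lrow' i j : j \in 0 :: iota 1 3 -> i \in rowJ sg j -> hexagon_label (i, j).
  rewrite inE => /orP [/eqP -> ii|jj]; first by apply: l0; apply: sub3 sgin ii.
  have -> : rowJ sg j = rcons [seq i <- rev sg | i != j] 0 by case: (j) jj.
  rewrite mem_rcons inE => /orP [/eqP ->|]; first by apply: l0'; rewrite inE jj orbT.
  rewrite mem_filter mem_rev => /andP [nij ii]; apply: lin; rewrite ?nij ?orbT //.
    by apply: sub3 sgin _; rewrite inE ii orbT.
  by rewrite inE jj orbT.
(* The order used in the computation is the actual order of the attachments on [C]; [sD] says the
   same for [D]. *)
have sC : sorted ltn [seq p u | u <- orderC b2 ta].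
  rewrite map_flatten -map_comp.
  rewrite (eq_map (_ : _ =1 fun i => [seq p (i, j) | j <- rowI b2 i])); last first.
    by move=> i /=; rewrite -map_comp.
  apply: (@sorted_blocks _ _ (fun i => a (lab (i, 0)))).
  - rewrite /= path_sortedE ?tas ?andbT; last exact: ltn_trans.
    apply/allP => _ /mapP [i ii ->]; rewrite /= ltn_neqAle mina andbT.
    have ii3 : i \in iota 1 3 by rewrite -(perm_mem (_ : perm_eq ta _)) // -mem_permutations.
    by rewrite (ha (0, 0) (i, 0)) //= ?[_ \in _]l0 ?i3 // eq_sym i3.
  - move=> i /(sub3 _ _ tain); rewrite inE => /orP [/eqP ->|ii].
      rewrite /= ; have := srtJ; rewrite /= !andbT => ->; rewrite andbT.
      have [] := h1 1; first by [].
      by move=> ->.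
    have := ii; rewrite !inE => /or3P [] /eqP ei; rewrite ei in ii *; rewrite /rowI.
    + have [e1 _] := h2 1 3 isT isT isT; have r := rowrev 1 2 3 isT isT isT isT isT isT.
      have z := p0 1 2 isT isT isT; case: (b2) e1 z => e1 z; first by rewrite /= e1 r.
      by rewrite /= r z.
    + have [e1 _] := h2 2 3 isT isT isT; have r := rowrev 2 1 3 isT isT isT isT isT isT.
      have z := p0 2 1 isT isT isT; case: (b2) e1 z => e1 z; first by rewrite /= e1 r.
      by rewrite /= r z.
    + have [e1 _] := h2 3 2 isT isT isT; have r := rowrev 3 1 2 isT isT isT isT isT isT.
      have z := p0 3 1 isT isT isT; case: (b2) e1 z => e1 z; first by rewrite /= e1 r.
      by rewrite /= r z.
  - move=> i i' /(sub3 _ _ tain) ii /(sub3 _ _ tain) ii' lt j j' jr jr'.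
    apply: (posC_seg cr).
    have /eqP -> : a (lab (i, j)) == a (lab (i, 0)) by rewrite ha ?[_ \in _]l0 ?[_ \in _]lrow /=.
    by have /eqP -> : a (lab (i', j')) == a (lab (i', 0)) by rewrite ha ?[_ \in _]l0 ?[_ \in _]lrow /=.
have sD : sorted ltn [seq q u | u <- orderD sg ta'].
  rewrite map_flatten -map_comp.
  rewrite (eq_map (_ : _ =1 fun j => [seq q (i, j) | i <- rowJ sg j])); last first.
    by move=> i /=; rewrite -map_comp.
  apply: (@sorted_blocks (fun j i => q (i, j)) _ (fun j => b (lab (0, j)))).
  - rewrite /= path_sortedE ?ta's ?andbT; last exact: ltn_trans.
    apply/allP => _ /mapP [i ii ->]; rewrite /= ltn_neqAle minb andbT.
    have ii3 : i \in iota 1 3 by rewrite -(perm_mem (_ : perm_eq ta' _)) // -mem_permutations.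
    by rewrite (hb (0, 0) (0, i)) //= ?[_ \in _]l0' ?i3 // eq_sym i3.
  - move=> j /(sub3 _ _ ta'in); rewrite inE => /orP [/eqP ->|jj].
      rewrite /= path_sortedE ?sgs ?andbT; last exact: ltn_trans.
      apply/allP => _ /mapP [i ii ->].
      have ii3 : i \in iota 1 3 by rewrite -(perm_mem (_ : perm_eq sg _)) // -mem_permutations.
      by have [_ e1] := h1 _ ii3; rewrite /= e1.
    have -> : rowJ sg j = rcons [seq i <- rev sg | i != j] 0 by case: (j) jj.
    have sg3 i : (i \in sg) = (i \in iota 1 3).
      by apply: perm_mem; rewrite -mem_permutations.
    rewrite sorted_pairwise; last exact: ltn_trans.
    rewrite map_rcons -cats1 pairwise_cat andbT; apply/andP; split.
      apply/allrelP => _ z /mapP [i ii ->]; rewrite inE => /eqP ->.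
      by move: ii; rewrite mem_filter mem_rev sg3 => /andP [ni ii]; apply: q0.
    rewrite -sorted_pairwise ?sorted_map; last exact: ltn_trans.
    have gs' : sorted (fun i i' => q (i', 0) < q (i, 0)) [seq i <- rev sg | i != j].
      apply: sorted_filter; first by move=> u v w /= uv vw; apply: ltn_trans vw uv.
      by rewrite rev_sorted; move: sgs; rewrite sorted_map.
    apply: (@sub_in_sorted _ [pred i | (i \in iota 1 3) && (i != j)]) gs'.
      by move=> i i' /andP [ii ni] /andP [ii' ni']; apply: colrev.
    by apply/allP => i; rewrite mem_filter mem_rev sg3 => /andP [ni ii]; apply/andP.
  - move=> i i' /(sub3 _ _ ta'in) ii /(sub3 _ _ ta'in) ii' lt j j' jr jr'.
    apply: (posD_seg cr).
    have /eqP -> : b (lab (j, i)) == b (lab (0, i)) by rewrite hb ?[_ \in _]l0' ?[_ \in _]lrow' /=.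
    by have /eqP -> : b (lab (j', i')) == b (lab (0, i')) by rewrite hb ?[_ \in _]l0' ?[_ \in _]lrow' /=.
set LC' := [seq l <- _ | _] in lU pC eCD gs; set LD' := [seq l <- _ | _] in pD eCD gs.
apply: (crossing_no_good_swap cr (lab := lab) _ eCD _ _ _ _ gs).
- move=> u v /(allP lU) hu /(allP lU) hv euv; apply/eqP; apply/negPn/negP => /(pneq _ _ hu hv).
  by rewrite euv eqxx.
- by move: sC; rewrite !sorted_map; apply: sorted_filter => u v w; apply: ltn_trans.
- by move: sD; rewrite !sorted_map; apply: sorted_filter => u v w; apply: ltn_trans.
- apply: (paired_sub _ lU pC).
  by move=> u v hu hv euv; apply/eqP; rewrite /= ha // euv.
- have lU' : all hexagon_label LD' by rewrite -(perm_all _ eCD).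
  apply: (paired_sub _ lU' pD).
  by move=> u v hu hv euv; apply/eqP; rewrite /= hb // euv.
Qed.
End Hexagon.

Lemma hexagon_swap C D x y a b lab b1 b2 b3 b4 :
  hexagon C D x y a b lab b1 b2 b3 b4 ->
  hexagon D C y x b a (fun u => lab (u.2, u.1)) b3 b4 b1 b2.
Proof.
have sw u : u \in hexagon_label -> (u.2, u.1) \in hexagon_label.
  by case/and3P=> h1 h2 h3; apply/and3P; split; rewrite //= orbCA [u.2 == u.1]eq_sym.
case=> ha hb h1 h2; split.
- by move=> u v /sw hu /sw hv; rewrite hb.
- by move=> u v /sw hu /sw hv; rewrite ha.
- by move=> i ii; have [] := h1 i ii.
- by move=> i j ii jj nij; rewrite eq_sym in nij; have [] := h2 j i jj ii nij.
Qed.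

Lemma hexagon_rev C D x y P a b lab b1 b2 b3 b4 M : (forall u, a u <= M) ->
  crossing C D x y P a b -> hexagon C D x y a b lab b1 b2 b3 b4 ->
  hexagon (rev C) D x y (fun u => M - a u) b lab (~~ b1) (~~ b2) b3 b4.
Proof.
move=> aM cr [ha hb h1 h2]; have pinj := posC_inj cr.
have xin u : x u \in C by have /andP [] := cr_x cr u.
have flip u v : lab u <> lab v -> (index (x (lab u)) (rev C) < index (x (lab v)) (rev C)) =
    ~~ (index (x (lab u)) C < index (x (lab v)) C).
  move=> nuv; rewrite !index_rev ?(cr_uC cr) //.
  have : index (x (lab u)) C <> index (x (lab v)) C by move/pinj.
  move: (xin (lab u)) (xin (lab v)); rewrite -!index_mem.
  by move: (index _ _) (index _ _) (size C) => m n k; clear; lia.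
have i3 i : i \in iota 1 3 -> (i < 4) * ((i == 0) = false) * ((0, i) \in hexagon_label) * ((i, 0) \in hexagon_label) * ((0,0) \in hexagon_label).
  by rewrite !inE => /or3P [] /eqP ->.
split=> //.
- move=> u v hu hv; rewrite -ha //; have := aM (lab u); have := aM (lab v).
  by move: (a _) (a _) => m n; clear; lia.
- move=> i ii; have [e1 e2] := h1 i ii; split=> //; rewrite flip ?e1 //.
  move=> eq; have := hb _ _ (i3 _ ii).2 (i3 _ ii).1.1.2; rewrite eq eqxx /= => /esym.
  by rewrite eq_sym (i3 _ ii).1.1.1.2.
- move=> i j ii jj nij; have [e1 e2] := h2 i j ii jj nij; split=> //; rewrite flip ?e1 //.
  have hij : (i, j) \in hexagon_label.
    by move: ii jj nij; rewrite !inE => /or3P [] /eqP -> /or3P [] /eqP ->.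
  move=> eq; have := hb _ _ (i3 _ ii).1.2 hij; rewrite eq eqxx /= => /esym.
  by rewrite eq_sym (i3 _ jj).1.1.1.2.
Qed.

(** Each comparison in [hexagon] is made within one segment, so it survives a rotation that brings
    I_0 to the front. *)
Lemma hexagon_rot C D x y P a b lab b1 b2 b3 b4 :
  crossing C D x y P a b -> hexagon C D x y a b lab b1 b2 b3 b4 ->
  exists C', exists a', [/\ crossing C' D x y P a' b,
    hexagon C' D x y a' b lab b1 b2 b3 b4 & forall u, a' (lab (0, 0)) <= a' u].
Proof.
move=> cr [ha hb h1 h2]; pose M := (\max_u a u).+1.
have aM u : a u < M by rewrite ltnS; apply: leq_bigmax.
have [n [cr' min' ord]] := crossing_rot (lab (0, 0)) aM cr.
exists (rot n C), (fun u => if a u < a (lab (0, 0)) then a u + M else a u); split=> //.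
have i3 i : i \in iota 1 3 -> ((0, i) \in hexagon_label) * ((i, 0) \in hexagon_label) * ((0,0) \in hexagon_label).
  by rewrite !inE => /or3P [] /eqP ->.
split=> //.
- move=> u v hu hv; rewrite -ha //; have hM := aM (lab u); have hM' := aM (lab v).
  by clearbody M; clear - hM hM'; do 2 case: ifP; lia.
- move=> i ii; have [<- e2] := h1 i ii; split=> //; apply: ord.
  by apply/eqP; rewrite ha ?i3.
- move=> i j ii jj nij; have [<- e2] := h2 i j ii jj nij; split=> //; apply: ord.
  have hij : (i, j) \in hexagon_label.
    by move: ii jj nij; rewrite !inE => /or3P [] /eqP -> /or3P [] /eqP ->.
  by apply/eqP; rewrite ha ?i3.
Qed.

(** The same permutation [f] of the indices, which fixes 0, acts on the I_i and on the J_j, so that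
    the missing edges I_i J_i remain the missing ones. *)
Lemma hexagon_relabel C D x y P a b lab b1 b2 b3 b4 :
  crossing C D x y P a b -> hexagon C D x y a b lab b1 b2 b3 b4 ->
  exists lab', [/\ hexagon C D x y a b lab' b1 b2 b3 b4, lab' (0, 0) = lab (0, 0) &
    sorted ltn [seq index (x (lab' (0, j))) C | j <- iota 1 3]].
Proof.
move=> cr [ha hb h1 h2]; have [|s sin srt] := @sort3 (fun j => index (x (lab (0, j))) C).
  move=> j j' ii ii' /(posC_inj cr) eqj; apply/eqP; rewrite -(hb (0, j) (0, j')) ?eqj //.
    by move: ii; rewrite !inE => /or3P [] /eqP ->.
  by move: ii'; rewrite !inE => /or3P [] /eqP ->.
pose f i := nth 0 (0 :: s) i.
have fP : all (fun s => all (fun i => all (fun j => let f := nth 0 (0 :: s) in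
    [&& f i < 4, (f i == 0) == (i == 0) & (f i == f j) == (i == j)]) (iota 0 4)) (iota 0 4))
    (permutations (iota 1 3)) by vm_compute.
have {fP} fP i j : i < 4 -> j < 4 -> [&& f i < 4, (f i == 0) == (i == 0) & (f i == f j) == (i == j)].
  move=> i4 j4; move/allP: fP => /(_ _ sin) /allP /(_ i); rewrite mem_iota => /(_ i4).
  by move/allP => /(_ j); rewrite mem_iota; apply.
have f3 i : i \in iota 1 3 -> f i \in iota 1 3.
  rewrite !mem_iota => /andP [i1 i4]; have /and3P [fi4 /eqP fi0 _] := fP _ _ i4 i4.
  by rewrite fi4 andbT lt0n fi0 -lt0n.
have fl u : u \in hexagon_label -> (f u.1, f u.2) \in hexagon_label.
  case/and3P=> i4 j4 h; have /and3P [fi4 /eqP fi0 /eqP fij] := fP _ _ i4 j4.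
  have /and3P [fj4 /eqP fj0 _] := fP _ _ j4 j4.
  by apply/and3P; rewrite /= fi0 fj0 fij.
exists (fun u => lab (f u.1, f u.2)); split=> //; first split.
- move=> u v hu hv; rewrite ha ?fl //=.
  by case/and3P: hu => hu _ _; case/and3P: hv => hv _ _; have /and3P [_ _ /eqP] := fP _ _ hu hv.
- move=> u v hu hv; rewrite hb ?fl //=.
  by case/and3P: hu => _ hu _; case/and3P: hv => _ hv _; have /and3P [_ _ /eqP] := fP _ _ hu hv.
- by move=> i /f3 /h1.
- move=> i j ii jj nij; apply: (h2 (f i) (f j)); rewrite ?f3 //.
  move: ii jj; rewrite !mem_iota => /andP [_ ii] /andP [_ jj].
  by have /and3P [_ _ /eqP ->] := fP _ _ ii jj.
- have : size s = 3 by rewrite (perm_size (_ : perm_eq s (iota 1 3))) // -mem_permutations.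
  by move: srt; rewrite /f; case: (s) => [|s1 [|s2 [|s3 []]]].
Qed.

(** Reversing [C] negates [b1] and [b2], reversing [D] negates [b3] and [b4], and swapping the
    cycles exchanges the two pairs. This reduces all cases to [b1 = b3 = true] and [b4 = false];
    rotations of both cycles and a renumbering then lead to the sorted case. *)
Lemma hexagon_absurd C D x y P a b lab b1 b2 b3 b4 :
  crossing C D x y P a b -> hexagon C D x y a b lab b1 b2 b3 b4 ->
  ~~ ((b1 == b2) && (b3 == b4)) -> False.
Proof.
have main C' D' x' y' P' a' b' lab' c : crossing C' D' x' y' P' a' b' ->
    hexagon C' D' x' y' a' b' lab' true c true false -> False.
  move=> cr hx; have [C1 [a1 [{}cr {}hx mina]]] := hexagon_rot cr hx.
  have [D1 [d1 [cr' hx' mind]]] := hexagon_rot (crossing_swap cr) (hexagon_swap hx).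
  have [l2 [hx2 e0 srt]] := hexagon_relabel (crossing_swap cr') (hexagon_swap hx').
  by apply: (hexagon_absurd_sorted (crossing_swap cr') hx2) srt; rewrite e0.
have main2 C' D' x' y' P' a' b' lab' c2 c4 : crossing C' D' x' y' P' a' b' ->
    hexagon C' D' x' y' a' b' lab' true c2 true c4 -> ~~ (c2 && c4) -> False.
  move=> cr hx; case: c4 hx => [|hx _]; last exact: main cr hx.
  case: c2 => // hx _; exact: main (crossing_swap cr) (hexagon_swap hx).
have main3 C' D' x' y' P' a' b' lab' c1 c2 c4 : crossing C' D' x' y' P' a' b' ->
    hexagon C' D' x' y' a' b' lab' c1 c2 true c4 -> ~~ ((c1 == c2) && c4) -> False.
  move=> cr hx; case: c1 hx => hx; first exact: main2 cr hx.
  have aM u : a' u <= \max_v a' v by apply: leq_bigmax.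
  by move=> h; apply: (main2 _ _ _ _ _ _ _ _ _ _ (crossing_rev aM cr) (hexagon_rev aM cr hx)); case: (c2) h.
move=> cr hx h; case: b1 hx h => hx h.
  by apply: (main3 _ _ _ _ _ _ _ _ _ _ _ (crossing_swap cr) (hexagon_swap hx)); rewrite andbC; case: (b2) h.
have aM u : a u <= \max_v a v by apply: leq_bigmax.
have cr' := crossing_rev aM cr; have hx' := hexagon_rev aM cr hx.
by apply: (main3 _ _ _ _ _ _ _ _ _ _ _ (crossing_swap cr') (hexagon_swap hx')); rewrite andbC; case: (b2) h.
Qed.

End Crossing.

(** * Counting hexagons *)

(** Cauchy-Schwarz, by summing [2 * (m * n) <= m ^ 2 + n ^ 2] over all pairs. *)
Lemma sqr_sum_leq (Y : finType) (n : Y -> nat) :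
  (\sum_y n y) ^ 2 <= #|Y| * \sum_y n y ^ 2.
Proof.
rewrite -(leq_pmul2l (isT : 0 < 2)).
have -> : 2 * (\sum_y n y) ^ 2 = \sum_y \sum_z 2 * (n y * n z).
  rewrite -mulnn big_distrl big_distrr /=; apply: eq_bigr => y _.
  by rewrite -big_distrr /= -big_distrr.
apply: leq_trans (_ : \sum_y \sum_z (n y ^ 2 + n z ^ 2) <= _).
  by apply: leq_sum => y _; apply: leq_sum => z _; apply: nat_Cauchy.
rewrite (eq_bigr (fun y => #|Y| * n y ^ 2 + \sum_z n z ^ 2)); last first.
  by move=> y _; rewrite big_split sum_nat_const.
by rewrite big_split /= sum_nat_const -big_distrr /= mul2n addnn.
Qed.

Lemma card_collisions (X Y : finType) (A : {set X}) (f : X -> Y) :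
  #|A| ^ 2 <= #|Y| * #|[set u : X * X | [&& u.1 \in A, u.2 \in A & f u.1 == f u.2]]|.
Proof.
pose n y := \sum_(x in A | f x == y) 1.
have -> : #|A| = \sum_y n y.
  by rewrite -sum1_card (partition_big f predT).
have -> : #|[set u : X * X | [&& u.1 \in A, u.2 \in A & f u.1 == f u.2]]| = \sum_y n y ^ 2.
  rewrite -sum1_card (eq_bigl (fun u : X * X => (u.1 \in A) && ((u.2 \in A) && (f u.2 == f u.1)))).
    rewrite -(pair_big_dep (mem A) (fun x x' => (x' \in A) && (f x' == f x)) (fun _ _ => 1)) /=.
    rewrite (partition_big f predT) //=; apply: eq_bigr => y _.
    rewrite (eq_bigr (fun _ => n y)) => [|x /andP [_ /eqP <-] //].
    by rewrite -[n y in LHS]mul1n -big_distrl.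
  by move=> u; rewrite inE [f u.1 == _]eq_sym.
exact: sqr_sum_leq.
Qed.

Lemma card_fibers (X Y : finType) (A : {set X}) (f : X -> Y) (B : {set Y}) m :
  {in A, forall x, f x \in B} -> #|B| * m < #|A| ->
  exists2 y, y \in B & m < #|[set x in A | f x == y]|.
Proof.
move=> fB lt; apply/exists_inP; apply: contraLR lt; rewrite -leqNgt.
move/exists_inPn => h; rewrite -sum1_card (partition_big f (mem B)) //=.
rewrite -sum_nat_const; apply: leq_sum => y yB.
by have := h y yB; rewrite -leqNgt -sum1dep_card.
Qed.

Section Bound.
Variables (T : finType) (e : rel T) (K : finType).
Hypothesis e_sym : symmetric e.
Variables (C D : seq T) (x y : K -> T) (P : K -> seq T) (a b : K -> nat).
Hypothesis cr : crossing e C D x y P a b.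

Let p u := index (x u) C.
Let q u := index (y u) D.
Let simple := crossing_simple e_sym cr.

(* [E] consists of paths between the neighbours of the ends of the edge [u0]; a path
   [u] in [E] closes up to a 4-cycle with [u0], [r1 u] and [r2 u]. *)
Section Corner.
Variables (u0 : K) (E : {set K}) (r1 r2 : K -> K) (b1 b2 b3 b4 : bool).
Hypothesis Ea : {in E, forall u, a u != a u0}.
Hypothesis Eb : {in E, forall u, b u != b u0}.
Hypothesis Er1 : {in E, forall u, a (r1 u) = a u0 /\ b (r1 u) = b u}.
Hypothesis Er2 : {in E, forall u, a (r2 u) = a u /\ b (r2 u) = b u0}.
Hypothesis Etype : {in E, forall u, [/\ (p u0 < p (r1 u)) = b1, (p (r2 u) < p u) = b2,
  (q u0 < q (r2 u)) = b3 & (q (r1 u) < q u) = b4]}.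

Lemma r1_eq u v : u \in E -> v \in E -> b u = b v -> r1 u = r1 v.
Proof.
by move=> /Er1 [h1 h2] /Er1 [h3 h4] eb; apply: simple; rewrite ?h1 ?h3 // h2 h4.
Qed.

Lemma r2_eq u v : u \in E -> v \in E -> a u = a v -> r2 u = r2 v.
Proof.
by move=> /Er2 [h1 h2] /Er2 [h3 h4] eb; apply: simple; rewrite ?h2 ?h4 // h1 h3.
Qed.

(** In the 4-cycle of [u], [u'], [r1 u] and [r1 u'] the two segments of [D] show the same order,
    since [b4] is common to [E]; by [crossing_no_parallel] the two segments of [C] show opposite
    orders. *)
Lemma r1_reverses u u' : u \in E -> u' \in E -> a u = a u' -> b u != b u' ->
  (p (r1 u) < p (r1 u')) = ~~ (p u < p u').
Proof.
move=> uE u'E au nbb.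
have [h1 h2] := Er1 uE; have [h1' h2'] := Er1 u'E.
have [_ _ _ t4] := Etype uE; have [_ _ _ t4'] := Etype u'E.
have : (p (r1 u) < p (r1 u')) = (p u < p u') -> False.
  move=> eq; apply: (crossing_no_parallel e_sym cr _ _ _ _ _ _ eq (etrans t4 (esym t4'))) => //.
  - by rewrite h1 h1'.
  - by rewrite h1 eq_sym Ea.
  - by rewrite h2 h2'.
by case: (p (r1 u) < _); case: (p u < _) => // /(_ erefl).
Qed.

Lemma r2_reverses u v : u \in E -> v \in E -> b u = b v -> a u != a v ->
  (q (r2 u) < q (r2 v)) = ~~ (q u < q v).
Proof.
move=> uE vE bu nab.
have [h1 h2] := Er2 uE; have [h1' h2'] := Er2 vE.
have [_ t4 _ _] := Etype uE; have [_ t4' _ _] := Etype vE.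
have : (q (r2 u) < q (r2 v)) = (q u < q v) -> False.
  move=> eq; apply: (crossing_no_parallel e_sym cr _ _ _ _ _ _ (etrans t4 (esym t4')) eq) => //.
  - by rewrite h2 h2'.
  - by rewrite h1 h1'.
  - by rewrite h2 eq_sym Eb.
by case: (q (r2 u) < _); case: (q u < _) => // /(_ erefl).
Qed.

(** Both segments of [C] in a 4-cycle of [E] reverse the order found on the segment of [u0], hence
    agree with each other. The same holds on [D], against [crossing_no_parallel]. *)
Lemma corner_C4_free u u' v v' : u \in E -> u' \in E -> v \in E -> v' \in E ->
  a u = a u' -> a v = a v' -> b u = b v -> b u' = b v' -> a u != a v -> b u = b u'.
Proof.
move=> uE u'E vE v'E au av bu bv nab; apply/eqP/negPn/negP => nbb.
apply: (crossing_no_parallel e_sym cr au av bu bv nab nbb).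
- have := r1_reverses uE u'E au nbb; have := r1_reverses vE v'E av.
  rewrite -(r1_eq uE vE bu) -(r1_eq u'E v'E bv) -bu -bv nbb => /(_ isT) ->.
  by move/negb_inj.
- have := r2_reverses uE vE bu nab; have := r2_reverses u'E v'E bv.
  rewrite -(r2_eq uE u'E au) -(r2_eq vE v'E av) -au -av nab => /(_ isT) ->.
  by move/negb_inj.
Qed.

(** Together with [u0] and the paths given by [r1] and [r2], a hexagon in [E] is a configuration
    excluded by [hexagon_absurd]. *)
Lemma corner_hexagon_free w1 w1' w2 w2' w3 w3' :
  w1 \in E -> w1' \in E -> w2 \in E -> w2' \in E -> w3 \in E -> w3' \in E ->
  a w1 = a w1' -> a w2 = a w2' -> a w3 = a w3' ->
  b w1 = b w2 -> b w2' = b w3' -> b w1' = b w3 ->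
  a w1 != a w2 -> a w1 != a w3 -> a w2 != a w3 ->
  b w1 != b w2' -> b w1' != b w2' -> b w1 != b w1' ->
  ~~ ((b1 == b2) && (b3 == b4)) -> False.
Proof.
move=> E1 E1' E2 E2' E3 E3' a1 a2 a3 e12 e23 e13 na12 na13 na23 nb1 nb2 nb3.
(* J_1 = b w2', J_2 = b w1', J_3 = b w1 and I_i = a wi *)
pose lab (ij : nat * nat) := match ij with
  | (0, 0) => u0 | (0, 1) => r1 w2' | (0, 2) => r1 w1' | (0, _) => r1 w1
  | (1, 0) => r2 w1 | (1, 2) => w1' | (1, _) => w1
  | (2, 0) => r2 w2 | (2, 1) => w2' | (2, _) => w2
  | (_, 0) => r2 w3 | (_, 1) => w3' | (_, _) => w3 end.
pose I i := match i with 0 => a u0 | 1 => a w1 | 2 => a w2 | _ => a w3 end.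
pose J i := match i with 0 => b u0 | 1 => b w2' | 2 => b w1' | _ => b w1 end.
have lI : {in hexagon_label, forall u, a (lab u) = I u.1 /\ b (lab u) = J u.2}.
  have [? ?] := Er1 E1; have [? ?] := Er1 E1'; have [? ?] := Er1 E2'.
  have [? ?] := Er2 E1; have [? ?] := Er2 E2; have [? ?] := Er2 E3.
  by case=> [[|[|[|[|i]]]] [|[|[|[|j]]]]] //= _; split; congruence.
have inj4 (f : nat -> nat) : f 0 != f 1 -> f 0 != f 2 -> f 0 != f 3 -> f 1 != f 2 ->
    f 1 != f 3 -> f 2 != f 3 -> forall i j, i < 4 -> j < 4 -> (f i == f j) = (i == j).
  move=> f01 f02 f03 f12 f13 f23 [|[|[|[|i]]]] [|[|[|[|j]]]] // _ _; rewrite ?eqxx //;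
  by apply/eqP => h; move: f01 f02 f03 f12 f13 f23; rewrite h ?eqxx.
apply: (hexagon_absurd e_sym (lab := lab) (b1 := b1) (b2 := b2) (b3 := b3) (b4 := b4) cr); split.
- move=> u v hu hv; rewrite (lI u hu).1 (lI v hv).1.
  case/and3P: hu => hu _ _; case/and3P: hv => hv _ _.
  by apply: inj4 => //=; rewrite eq_sym Ea.
- move=> u v hu hv; rewrite (lI u hu).2 (lI v hv).2.
  case/and3P: hu => _ hu _; case/and3P: hv => _ hv _.
  by apply: inj4 => //=; rewrite 1?eq_sym ?Eb // eq_sym.
- have [? _ ? _] := Etype E1; have [? _ ? _] := Etype E1'; have [? _ ? _] := Etype E2'.
  have [_ _ ? _] := Etype E2; have [_ _ ? _] := Etype E3.
  by move=> i; rewrite !inE => /or3P [] /eqP ->.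
- have er2 u v := @r2_eq u v; have er1 u v := @r1_eq u v.
  have [_ ? _ ?] := Etype E1; have [_ + _ +] := Etype E1'; have [_ + _ +] := Etype E2'.
  have [_ ? _ +] := Etype E2; have [_ ? _ +] := Etype E3; have [_ + _ +] := Etype E3'.
  rewrite -(er2 w1 w1') // -(er2 w2 w2') // -(er2 w3 w3') //.
  rewrite -(er1 w1 w2) // -(er1 w2' w3') // -(er1 w1' w3) // => ? ? ? ? ? ? ? ?.
  by move=> i j; rewrite !inE => /or3P [] /eqP -> /or3P [] /eqP -> //= _; split.
Qed.

Hypothesis types : ~~ ((b1 == b2) && (b3 == b4)).
Variables d t : nat.
Hypothesis degA : #|[set u | a u == a u0]| <= d.
Hypothesis degB : #|[set u | b u == b u0]| <= d.
Hypothesis dt : d <= t ^ 3.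

Let r1in : {in E, forall u, r1 u \in [set u | a u == a u0]}.
Proof. by move=> u /Er1 [h _]; rewrite inE h. Qed.

Let r2in : {in E, forall u, r2 u \in [set u | b u == b u0]}.
Proof. by move=> u /Er2 [_ h]; rewrite inE h. Qed.

(** The path [r2 u] determines the segment [a u], and it takes at most [d] values; a low segment
    carries at most [t] paths of [E]. *)
Lemma few_low_a : #|[set u in E | #|[set v in E | a v == a u]| <= t]| <= d * t.
Proof.
rewrite leqNgt; apply/negP => lt.
have [||v _ lt'] := @card_fibers _ _ _ r2 [set u | b u == b u0] t _ (leq_ltn_trans _ lt).
- by move=> u; rewrite inE => /andP [/r2in].
- by rewrite leq_mul2r degB orbT.
have [u] : exists u, u \in [set u in [set u in E | #|[set v in E | a v == a u]| <= t] | r2 u == v].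
  by apply/card_gt0P; apply: leq_ltn_trans lt'.
rewrite !inE => /andP [/andP [uE le]] /eqP ru; move: lt'; rewrite ltnNge => /negP; apply.
apply: leq_trans le; apply: subset_leq_card; apply/subsetP => w; rewrite !inE.
by move=> /andP [/andP [wE _]] /eqP rw; rewrite wE /= -(Er2 wE).1 -(Er2 uE).1 rw ru.
Qed.

Lemma few_low_b : #|[set u in E | #|[set v in E | b v == b u]| <= t]| <= d * t.
Proof.
rewrite leqNgt; apply/negP => lt.
have [||v _ lt'] := @card_fibers _ _ _ r1 [set u | a u == a u0] t _ (leq_ltn_trans _ lt).
- by move=> u; rewrite inE => /andP [/r1in].
- by rewrite leq_mul2r degA orbT.
have [u] : exists u, u \in [set u in [set u in E | #|[set v in E | b v == b u]| <= t] | r1 u == v].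
  by apply/card_gt0P; apply: leq_ltn_trans lt'.
rewrite !inE => /andP [/andP [uE le]] /eqP ru; move: lt'; rewrite ltnNge => /negP; apply.
apply: leq_trans le; apply: subset_leq_card; apply/subsetP => w; rewrite !inE.
by move=> /andP [/andP [wE _]] /eqP rw; rewrite wE /= -(Er1 wE).2 -(Er1 uE).2 rw ru.
Qed.

(** The paths of three edges in the graph [E]: [w.1] is the middle edge, [w.2.1] continues it at its
    end on [D], and [w.2.2] at its end on [C]. *)
Definition corner_paths : {set K * (K * K)} := [set w |
  [&& w.1 \in E, w.2.1 \in E, w.2.2 \in E, b w.2.1 == b w.1, w.2.1 != w.1,
      a w.2.2 == a w.1 & w.2.2 != w.1]].

(** [r2 v] and [r1 w] determine the two end segments of the path. Two different paths with the same
    ends would form a hexagon in [E], or a 4-cycle if they share an inner segment. *)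
Lemma corner_path_unique u v w u' v' w' :
  (u, (v, w)) \in corner_paths -> (u', (v', w')) \in corner_paths ->
  r2 v = r2 v' -> r1 w = r1 w' -> (u, (v, w)) = (u', (v', w')).
Proof.
rewrite !inE /= => /and5P [uE vE wE /eqP buv /and3P [nvu /eqP awu nwu]].
move=> /and5P [u'E v'E w'E /eqP buv' /and3P [nvu' /eqP awu' nwu']] rv rw.
have av : a v = a v' by rewrite -(Er2 vE).1 -(Er2 v'E).1 rv.
have bw : b w = b w' by rewrite -(Er1 wE).2 -(Er1 w'E).2 rw.
have navu : a v != a u by apply: contraNneq nvu => h; apply/eqP/simple.
have navu' : a v' != a u' by apply: contraNneq nvu' => h; apply/eqP/simple.
have nbwu : b w != b u by apply: contraNneq nwu => h; apply/eqP/simple.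
have nbwu' : b w' != b u' by apply: contraNneq nwu' => h; apply/eqP/simple.
have [eau|nau] := eqVneq (a u) (a u').
  have eww : w = w' by apply: simple; rewrite // awu eau -awu'.
  have [ebu|nbu] := eqVneq (b u) (b u').
    have euu : u = u' by apply: simple.
    have evv : v = v' by apply: simple; rewrite // buv ebu.
    by rewrite euu evv eww.
  have := corner_C4_free vE v'E uE u'E av eau buv buv' navu.
  by rewrite buv buv' => h; rewrite h eqxx in nbu.
have [ebu|nbu] := eqVneq (b u) (b u').
  have := corner_C4_free uE wE u'E w'E (esym awu) (esym awu') ebu bw nau.
  by move=> h; rewrite h eqxx in nbwu.
case: (corner_hexagon_free vE v'E uE wE u'E w'E) => //.
- by rewrite av.
- by rewrite buv eq_sym.
- by rewrite buv' bw eq_sym.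
- by rewrite buv buv'.
Qed.

(* If few segments have low degree in [E], then [E] contains more paths of length 3
   than there are pairs of end points, hence a hexagon. *)
Lemma corner_bound : #|E| <= 3 * (d * t).
Proof.
rewrite leqNgt; apply/negP => big.
pose lowA := [set u in E | #|[set v in E | a v == a u]| <= t].
pose lowB := [set u in E | #|[set v in E | b v == b u]| <= t].
pose G := E :\: lowA :\: lowB.
(* By [few_low_a] and [few_low_b] at most [2 * (d * t)] edges are removed. *)
have cG : d * t < #|G|.
  have h1 : #|E| <= #|lowA| + #|E :\: lowA|.
    by rewrite -(cardsID lowA E) leq_add2r subset_leq_card // subsetIr.
  have h2 : #|E :\: lowA| <= #|lowB| + #|G|.
    by rewrite -(cardsID lowB (E :\: lowA)) leq_add2r subset_leq_card // subsetIr.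
  move: (few_low_a) (few_low_b) h1 h2 big; rewrite -/lowA -/lowB.
  by move: #|lowA| #|lowB| #|E :\: lowA| #|G| #|E| (d * t) => ? ? ? ? ? ?; clear; lia.
(* At either end of an edge in [G] there are more than [t] edges, itself included, so it is the
   middle of at least [t ^ 2] paths. *)
have cP : #|G| * t ^ 2 <= #|corner_paths|.
  pose F u := setX [set v in E | (b v == b u) && (v != u)] [set w in E | (a w == a u) && (w != u)].
  have -> : #|corner_paths| = \sum_(u in E) #|F u|.
    rewrite (eq_bigr (fun u => \sum_(vw in F u) 1)) => [|u _]; last by rewrite sum1_card.
    rewrite pair_big_dep -sum1_card; apply: eq_bigl => -[u [v w]].
    by rewrite !inE /=; do 7 case: (_ \in _) || case: (_ == _).
  apply: leq_trans (_ : \sum_(u in G) #|F u| <= _); last first.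
    by rewrite [leqRHS](big_setID G) /= (setIidPr _) ?leq_addr // !(subset_trans (subsetDl _ _)) // subsetDl.
  rewrite -sum_nat_const; apply: leq_sum => u; rewrite !inE => /and3P [].
  rewrite !negb_and -!ltnNge => /orP [/negP//|lb] /orP [/negP//|la] uE.
  rewrite cardsX -mulnn.
  have cut (f : K -> nat) : t < #|[set v in E | f v == f u]| -> t <= #|[set v in E | (f v == f u) && (v != u)]|.
    rewrite (cardsD1 u) !inE uE eqxx add1n ltnS => /leq_trans; apply.
    by apply: subset_leq_card; apply/subsetP => v; rewrite !inE => /and3P [-> -> ->].
  by apply: leq_mul; apply: cut.
have [||[v w] _] := @card_fibers _ _ corner_paths (fun w => (r2 w.2.1, r1 w.2.2))
    (setX [set u | b u == b u0] [set u | a u == a u0]) 1.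
- move=> [u [v w]]; rewrite [in X in X -> _]inE /= => /and5P [uE vE wE _ _].
  by rewrite in_setX r2in ?r1in.
- rewrite muln1 cardsX; apply: leq_trans cP.
  apply: leq_ltn_trans (leq_mul degB degA) _.
  (* If [t] were 0, then [d] would be 0 as well and [E] would be empty. *)
  have t0 : 0 < t by case: (t) cG dt => //; rewrite muln0 exp0n // leqn0 => _ /eqP d0;
    move: big; rewrite d0 mul0n muln0 => /card_gt0P [u /r1in]; have := degA; rewrite d0 leqn0 cards_eq0 => /eqP ->; rewrite inE.
  (* [(d * t + 1) * t ^ 2 > d * t ^ 3 >= d ^ 2], the number of pairs of ends. *)
  apply: leq_trans (_ : (d * t).+1 * t ^ 2 <= _); last by rewrite leq_mul2r cG orbT.
  rewrite mulSn -mulnA -expnS -[X in X < _]add0n -addSn leq_add ?expn_gt0 ?t0 //.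
  by rewrite leq_mul2l dt orbT.
case/card_gt1P=> -[u1 [v1 w1]] [[u2 [v2 w2]] [/setIdP [m1 /eqP q1] /setIdP [m2 /eqP q2] /eqP]].
have [rv rw] : r2 v1 = r2 v2 /\ r1 w1 = r1 w2 by move: q1 q2 => /= <- [].
by apply; apply: corner_path_unique m1 m2 rv rw.
Qed.
End Corner.

Variables N d t : nat.
Hypothesis aN : forall u, a u < N.
Hypothesis bN : forall u, b u < N.
Hypothesis degA : forall v, #|[set u | a u == a v]| <= d.
Hypothesis degB : forall v, #|[set u | b u == b v]| <= d.
Hypothesis dt : d <= t ^ 3.

(** The mates complete [u0] and [u] to a 4-cycle if that is possible. The default [u0] does no harm,
    as [corner] tests the ends of the mates. *)
Definition corner_mate1 (u0 u : K) := odflt u0 [pick z | (a z == a u0) && (b z == b u)].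
Definition corner_mate2 (u0 u : K) := odflt u0 [pick z | (a z == a u) && (b z == b u0)].

Definition corner_type (u0 u : K) : bool * bool * (bool * bool) :=
  let v := corner_mate1 u0 u in let w := corner_mate2 u0 u in
  ((p u0 < p v, p w < p u), (q u0 < q w, q v < q u)).

Definition corner (u0 : K) (c : bool * bool * (bool * bool)) : {set K} :=
  [set u | let v := corner_mate1 u0 u in let w := corner_mate2 u0 u in
    [&& a u != a u0, b u != b u0, a v == a u0, b v == b u, a w == a u, b w == b u0
      & corner_type u0 u == c]].

(** If [b1 = b2] and [b3 = b4], a single element gives a 4-cycle that contradicts
    [crossing_no_parallel]; the other types fall under [corner_bound]. *)
Lemma card_corner u0 c : #|corner u0 c| <= 3 * (d * t).
Proof.
have Ein u : u \in corner u0 c -> [/\ a u != a u0, b u != b u0,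
    a (corner_mate1 u0 u) = a u0 /\ b (corner_mate1 u0 u) = b u,
    a (corner_mate2 u0 u) = a u /\ b (corner_mate2 u0 u) = b u0 & corner_type u0 u = c].
  by rewrite inE /= => /and5P [h1 h2 /eqP h3 /eqP h4 /and3P [/eqP h5 /eqP h6 /eqP h7]].
case: c Ein => -[b1 b2] [b3 b4] Ein.
have [/andP [/eqP eb1 /eqP eb3]|ty] := boolP ((b1 == b2) && (b3 == b4)).
  rewrite leqNgt; apply/negP => lt; have [u uE] : exists u, u \in corner u0 (b1, b2, (b3, b4)).
    by apply/card_gt0P; apply: leq_ltn_trans lt.
  have [nau nbu [h1 h2] [h3 h4]] := Ein u uE; rewrite /corner_type /= => -[t1 t2 t3 t4].
  apply: (crossing_no_parallel e_sym cr (u := u0) (u' := corner_mate1 u0 u)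
    (v := corner_mate2 u0 u) (v' := u)) => //.
  - by rewrite h3 eq_sym.
  - by rewrite h2 eq_sym.
  - by rewrite -/(p u0) -/(p (corner_mate1 u0 u)) t1 eb1 -t2.
  - by rewrite -/(q u0) -/(q (corner_mate2 u0 u)) t3 eb3 -t4.
apply: (@corner_bound u0 _ (corner_mate1 u0) (corner_mate2 u0) b1 b2 b3 b4) => //.
- by move=> u /Ein [].
- by move=> u /Ein [].
- by move=> u /Ein [].
- by move=> u /Ein [].
- by move=> u /Ein [_ _ _ _ [<- <- <- <-]].
Qed.

(* There are at least |K|^4 / N^4 closed walks of length 4, so some edge u0 lies on
   |K|^3 / N^4 of them. *)
Lemma crossing_bound : #|K| ^ 3 <= N ^ 4 * (48 * (d * t) + 2 * d).
Proof.
have [v0 _|K0] := pickP (fun _ : K => true); last first.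
  by rewrite eq_card0 // => u; have := K0 u.
pose fa u := Ordinal (aN u); pose fb u := Ordinal (bN u).
pose W := [set u : K * K | [&& u.1 \in [set: K], u.2 \in [set: K] & fa u.1 == fa u.2]].
have cW : #|K| ^ 2 <= N * #|W|.
  by have := card_collisions [set: K] fa; rewrite cardsT card_ord.
(* The closed walks of length 4, degenerate ones included. The two collision bounds give
   [#|K| ^ 4 <= N ^ 4 * #|Q|]. *)
pose Q := [set w : (K * K) * (K * K) | [&& w.1 \in W, w.2 \in W &
   (fb w.1.1, fb w.1.2) == (fb w.2.1, fb w.2.2)]].
have cQ : #|W| ^ 2 <= N ^ 2 * #|Q|.
  by have := card_collisions W (fun w => (fb w.1, fb w.2)); rewrite card_prod card_ord mulnn.
have QP w : w \in Q -> [/\ a w.1.1 = a w.1.2, a w.2.1 = a w.2.2, b w.1.1 = b w.2.1 & b w.1.2 = b w.2.2].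
  rewrite !inE /= => /and3P [/eqP [h1] /eqP [h2] /eqP [h3 h4]].
  by split.
(* The possible edges opposite to [u0] in such a walk: those of the sixteen types, whence 48 = 16 *
   3, and those that share a segment with [u0]. *)
pose S u0 := (\bigcup_c corner u0 c) :|: ([set u | a u == a u0] :|: [set u | b u == b u0]).
have cS u0 : #|S u0| <= 48 * (d * t) + 2 * d.
  apply: leq_trans (leq_card_setU _ _) _; apply: leq_add.
    apply: leq_trans (_ : \sum_c #|corner u0 c| <= _).
      by elim/big_rec2: _ => [|c n A _ le]; rewrite ?cards0 // (leq_trans (leq_card_setU _ _)) ?leq_add2l.
    apply: (@leq_trans (\sum_(c : bool * bool * (bool * bool)) 3 * (d * t))).
      by apply: leq_sum => c _; apply: card_corner.
    by rewrite sum_nat_const !card_prod card_bool; lia.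
  by apply: leq_trans (leq_card_setU _ _) _; rewrite mul2n -addnn leq_add.
have cQ2 : #|Q| <= #|K| * (48 * (d * t) + 2 * d).
  (* Two opposite edges determine the walk, because there are no double edges. *)
  pose g (w : (K * K) * (K * K)) := (w.1.1, w.2.2).
  have gI : {in Q &, injective g}.
    move=> [[z1 z2] [z3 z4]] [[z1' z2'] [z3' z4']] /QP /= [h1 h2 h3 h4] /QP /= [k1 k2 k3 k4] [e1 e2].
    have e3 : z2 = z2' by apply: simple; rewrite ?h4 ?k4 ?e2 // -h1 -k1 e1.
    have e4 : z3 = z3' by apply: simple; rewrite ?h2 ?k2 ?e2 // -h3 -k3 e1.
    by rewrite e1 e2 e3 e4.
  rewrite -(card_in_imset gI) -sum_nat_const.
  apply: leq_trans (_ : \sum_(u0 : K) #|S u0| <= _); last by apply: leq_sum => u0 _; apply: cS.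
  rewrite (eq_bigr (fun u0 => \sum_(u in S u0) 1)) => [|u0 _]; last by rewrite sum1_card.
  rewrite pair_big_dep /= sum1dep_card; apply: subset_leq_card; apply/subsetP => _ /imsetP [[[z1 z2] [z3 z4]] zQ ->].
  have [/= h1 h2 h3 h4] := QP _ zQ; rewrite !inE /g /=.
  have [//|na] := eqVneq (a z4) (a z1); first by rewrite orbT.
  have [//|nb] := eqVneq (b z4) (b z1); first by rewrite !orbT.
  rewrite !orbF; apply/bigcupP; exists (corner_type z1 z4) => //; rewrite inE /= na nb eqxx andbT /=.
  rewrite /corner_mate1 /corner_mate2; case: pickP => [z /andP [-> ->] /=|/(_ z2)]; last by rewrite h1 h4 !eqxx.
  by case: pickP => [z' /andP [-> ->] //=|/(_ z3)]; rewrite h2 h3 !eqxx.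
have K0 : 0 < #|K| by apply/card_gt0P; exists v0.
rewrite -(leq_pmul2l K0).
rewrite -expnS; apply: leq_trans (_ : N ^ 2 * #|W| ^ 2 <= _).
  by rewrite -expnMn -[4]/(2 * 2) expnM leq_exp2r.
apply: leq_trans (leq_mul (leqnn _) cQ) _.
by rewrite mulnA -expnD [leqRHS]mulnCA leq_mul2l cQ2 orbT.
Qed.

End Bound.

(** * Menger's theorem *)

Section UniqFlatten.
Variable T : eqType.
Implicit Types (ps qs : seq (seq T)) (p q : seq T).

Lemma mem_uniq_flatten ps p q z :
  uniq (flatten ps) -> p \in ps -> q \in ps -> z \in p -> z \in q -> p = q.
Proof.
elim: ps => //= r ps IH; rewrite cat_uniq => /and3P [_ /hasPn dis ups].
have no r' : r' \in ps -> z \in r -> z \in r' -> False.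
  move=> r'ps zr zr'; have /dis : z \in flatten ps by apply/flattenP; exists r'.
  by rewrite /= zr.
rewrite !inE => /predU1P [->|pps] /predU1P [->|qps] //; last exact: IH.
  by move=> zr /(no _ qps zr).
by move=> zp /(no _ pps) /(_ zp).
Qed.

Lemma uniq_flatten_mem ps p : uniq (flatten ps) -> p \in ps -> uniq p.
Proof.
elim: ps => //= r ps IH; rewrite cat_uniq => /and3P [ur _ /IH {}IH].
by rewrite inE => /predU1P [->|].
Qed.

Lemma uniq_flatten_sub ps qs :
  uniq (flatten ps) -> uniq qs -> {subset qs <= ps} -> uniq (flatten qs).
Proof.
move=> ups; elim: qs => //= q qs IH /andP [nq uq] sub.
rewrite cat_uniq IH ?andbT //; last by move=> r rq; apply: sub; rewrite inE rq orbT.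
rewrite (uniq_flatten_mem ups) ?sub ?mem_head //=.
apply/hasPn => z /flattenP [r rq zr]; apply/negP => zq.
have e : q = r by apply: mem_uniq_flatten ups _ _ zq zr; apply: sub; rewrite inE ?rq ?eqxx ?orbT.
by rewrite e rq in nq.
Qed.

Lemma uniq_map_flatten ps (f : seq T -> T) :
  uniq (flatten ps) -> {in ps, forall p, f p \in p} -> uniq (map f ps).
Proof.
elim: ps => //= p ps IH; rewrite cat_uniq => /and3P [_ /hasPn dis ups] fin.
rewrite IH ?andbT //; last by move=> q qps; apply: fin; rewrite inE qps orbT.
apply/mapP => -[q qps eq]; have qin : f q \in q by apply: fin; rewrite inE qps orbT.
have /dis : f q \in flatten ps by apply/flattenP; exists q.
by rewrite /= -eq fin ?mem_head.
Qed.

End UniqFlatten.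

Section Menger.
Variable T : finType.
Implicit Types (e : rel T) (A B S Z : {set T}).

Definition walk_between e A B (p : seq T) :=
  if p is x :: p' then [&& path e x p', x \in A & last x p' \in B] else false.

Definition linkage e A B (ps : seq (seq T)) :=
  all (walk_between e A B) ps /\ uniq (flatten ps).

Definition separates e A B S :=
  forall p, walk_between e A B p -> has (mem S) p.

Lemma sub_linkage e e' A B ps : subrel e' e -> linkage e' A B ps -> linkage e A B ps.
Proof.
move=> sub [h u]; split=> //; apply: sub_all h => -[|x p] //= /and3P [pp -> ->].
by rewrite (sub_path sub pp).
Qed.

Section RemoveArc.
Variables (e : rel T) (x y : T).
Let e' : rel T := fun u v => e u v && ((u, v) != (x, y)).

Lemma path_before_arc z p : path e z p ->
  path e' z p \/ exists p1 p2, [/\ p = p1 ++ p2, path e' z p1 & last z p1 = x].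
Proof.
elim: p z => [|w p IH] z /=; first by left.
case/andP=> ezw pp; have [[-> ->]|ne] := eqVneq (z, w) (x, y).
  by right; exists [::], (y :: p).
case: (IH w pp) => [->|[p1 [p2 [-> h1 h2]]]]; first by left; rewrite /e' ezw ne.
by right; exists (w :: p1), p2; rewrite /= {1}/e' ezw ne.
Qed.

Lemma path_after_arc z p : path e z p ->
  path e' z p \/ exists p1 p2, [/\ p = p1 ++ y :: p2 & path e' y p2].
Proof.
elim: p z => [|w p IH] z /=; first by left.
case/andP=> ezw pp; case: (IH w pp) => [h|[p1 [p2 [-> h]]]]; last first.
  by right; exists (w :: p1), p2.
have [[_ ew]|ne] := eqVneq (z, w) (x, y).
  by right; exists [::], p; rewrite -ew.
by left; rewrite /e' ezw ne.
Qed.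

(** A walk from [A] to [B] reaches [x] before it first uses the arc, or avoids the arc and meets
    [S]. Either way an initial part without the arc ends in [x |: S], so it meets [Z]. *)
Lemma separates_before A B S Z :
  separates e' A B S -> separates e' A (x |: S) Z -> separates e A B Z.
Proof.
move=> sepS sepZ [|z p] //= /and3P [pp zA lB].
have pre p1 p2 : p = p1 ++ p2 -> path e' z p1 -> last z p1 \in x |: S -> (z \in Z) || has (mem Z) p.
  move=> -> h1 h2; have := sepZ (z :: p1); rewrite /= h1 h2 zA => /(_ isT).
  by rewrite has_cat orbA => ->.
case: (path_before_arc pp) => [h|[p1 [p2 [ep h1 h2]]]]; last first.
  by apply: pre ep h1 _; rewrite h2 setU11.
have := sepS (z :: p); rewrite /= h zA lB => /(_ isT) /orP [zS|/hasP [s sp sS]].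
  by apply: (pre [::] p) => //; rewrite /= inE zS orbT.
case/splitPr: sp h pre => p1 p2 h pre; apply: (pre (rcons p1 s) p2).
- by rewrite cat_rcons.
- by move: h; rewrite -cat_rcons cat_path => /andP [].
- by rewrite last_rcons inE [s \in S]sS orbT.
Qed.

Lemma separates_after A B S Z :
  separates e' A B S -> separates e' (y |: S) B Z -> separates e A B Z.
Proof.
move=> sepS sepZ [|z p] //= /and3P [pp zA lB].
have suf p1 w p2 : z :: p = p1 ++ w :: p2 -> path e' w p2 -> w \in y |: S -> has (mem Z) (z :: p).
  move=> ep h1 h2; have hz : has (mem Z) (w :: p2).
    apply: sepZ; rewrite /= h1 h2; move: lB.
    by rewrite -(last_cons z z p) ep last_cat.
  by rewrite ep has_cat hz orbT.
case: (path_after_arc pp) => [h|[p1 [p2 [ep h1]]]]; last first.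
  by apply: (suf (z :: p1) y p2); rewrite ?ep // setU11.
have := sepS (z :: p); rewrite /= h zA lB => /(_ isT) /orP [zS|/hasP [s sp sS]].
  by apply: (suf [::] z p) => //; rewrite inE [z \in S]zS orbT.
case/splitPr: sp h suf => p1 p2 h suf; apply: (suf (z :: p1) s p2) => //.
- by move: h; rewrite cat_path /= => /and3P [].
- by rewrite inE [s \in S]sS orbT.
Qed.

End RemoveArc.

(** Disjoint walks have distinct marked vertices [f p], so a set [Z] that contains all of these and
    is no larger than [ps] is in bijection with the walks; [g] is the inverse. *)
Lemma linkage_nth e A B ps (f : seq T -> T) : linkage e A B ps ->
  {in ps, forall p, f p \in p} -> forall Z, #|Z| <= size ps -> {in ps, forall p, f p \in Z} ->
  #|Z| = size ps /\ exists g : T -> seq T, {in Z, forall z, g z \in ps /\ f (g z) = z}.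
Proof.
move=> [_ ups] fin Z cZ fZ; have um := uniq_map_flatten ups fin.
have sub : {subset map f ps <= enum Z}.
  by move=> _ /mapP [p pps ->]; rewrite mem_enum fZ.
have [|sz eq] := uniq_min_size um sub; first by rewrite size_map -cardE.
split; first by rewrite cardE -sz size_map.
exists (fun z => nth [::] ps (index z (map f ps))) => z zZ.
have zin : z \in map f ps by rewrite eq mem_enum.
have lt : index z (map f ps) < size ps by rewrite -(size_map f) index_mem.
by split; [rewrite mem_nth | rewrite -(nth_map [::] z) // nth_index].
Qed.

(* Goering's proof, by induction on the number of arcs. *)
Theorem menger e A B s : (forall S, separates e A B S -> s <= #|S|) ->
  exists2 ps, size ps = s & linkage e A B ps.
Proof.
have [n] := ubnP #|[set z : T * T | e z.1 z.2]|.
elim: n e A B => // n IH e A B le sep.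
have [noe|/forallPn [[x y]] /negPn /= exy] := boolP [forall z : T * T, ~~ e z.1 z.2]; last first.
  pose e' : rel T := fun u v => e u v && ((u, v) != (x, y)).
  have sub : subrel e' e by move=> u v /andP [].
  have {}IH A' B' := IH e' A' B'.
  have {le} le : #|[set z : T * T | e' z.1 z.2]| < n.
    rewrite ltnS in le; apply: leq_trans le; apply: proper_card; apply/properP; split.
      by apply/subsetP => z; rewrite !inE => /sub.
    by exists (x, y); rewrite inE //= /e' eqxx andbF.
  have [h|] := boolp.EM (forall S, separates e' A B S -> s <= #|S|).
    have [ps sz lk] := IH A B le h; exists ps => //; exact: sub_linkage sub lk.
  move/boolp.existsNP => [S /boolp.not_implyP [sepS /negP]]; rewrite -ltnNge => ltS.
  (* A separator of [A] from [x |: S], or of [y |: S] from [B], without the arc separates [A] from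
     [B] with it, so it has at least [s] vertices and the induction hypothesis applies. *)
  have [ps1 sz1 lk1] := IH A (x |: S) le (fun Z h => sep Z (separates_before sepS h)).
  have [ps2 sz2 lk2] := IH (y |: S) B le (fun Z h => sep Z (separates_after sepS h)).
  have cU z : #|z |: S| <= s by rewrite cardsU1; apply: leq_trans ltS; rewrite -add1n leq_add2r leq_b1.
  have walk1 p : p \in ps1 -> walk_between e' A (x |: S) p by move/(allP lk1.1).
  have walk2 p : p \in ps2 -> walk_between e' (y |: S) B p by move/(allP lk2.1).
  have [|||cx [pa paP]] := @linkage_nth _ _ _ _ (fun p => last x p) lk1 _ (x |: S).
  - by case=> [|z p] /walk1 //= _; apply: mem_last.
  - by rewrite sz1.
  - by case=> [|z p] /walk1 //= /and3P [].
  have [|||cy [pb pbP]] := @linkage_nth _ _ _ _ (fun p => head y p) lk2 _ (y |: S).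
  - by case=> [|z p] /walk2 //= _; rewrite inE eqxx.
  - by rewrite sz2.
  - by case=> [|z p] /walk2 //= /and3P [].
  have xS : x \notin S by move: cx; rewrite sz1 cardsU1; case: (x \in S) => //= h; move: ltS; rewrite -h ltnn.
  have yS : y \notin S by move: cy; rewrite sz2 cardsU1; case: (y \in S) => //= h; move: ltS; rewrite -h ltnn.
  have endA v z : v \in x |: S -> z \in x |: S -> z \in pa v -> z = v.
    move=> vP zP zin; have [m1 e1] := paP v vP; have [m2 e2] := paP z zP.
    have zz : z \in pa z by rewrite -{1}e2; case: (pa z) (walk1 _ m2) => //= w p _; apply: mem_last.
    by rewrite -e1 -e2 (mem_uniq_flatten lk1.2 m1 m2 zin zz).
  have startB v z : v \in y |: S -> z \in y |: S -> z \in pb v -> z = v.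
    move=> vP zP zin; have [m1 e1] := pbP v vP; have [m2 e2] := pbP z zP.
    have zz : z \in pb z by rewrite -{1}e2; case: (pb z) (walk2 _ m2) => //= w p _; rewrite inE eqxx.
    by rewrite -e1 -e2 (mem_uniq_flatten lk2.2 m1 m2 zin zz).
  (* Walks of the two linkages meet only in [S]: otherwise switching from one to the other at [z]
     would give a walk from [A] to [B] that avoids both the arc and [S]. *)
  have meet v w z : v \in x |: S -> w \in y |: S -> z \in pa v -> z \in pb w ->
      [/\ z \in S, z = v & z = w].
    move=> vP wQ zv zw; have [mv ev] := paP v vP; have [mw ew] := pbP w wQ.
    suff : (z \in S) by move=> zS; split=> //; [apply: endA|apply: startB]; rewrite // inE zS orbT.
    have uv := uniq_flatten_mem lk1.2 mv; have uw := uniq_flatten_mem lk2.2 mw.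
    have wv := walk1 _ mv; have ww := walk2 _ mw.
    have eAv := endA v _ vP; have sBw := startB w _ wQ.
    case/splitPr: zv uv ev wv eAv => a1 a2 uv ev wv eAv.
    case/splitPr: zw uw ew ww sBw => b1 b2 uw ew ww sBw.
    have /hasP [s0 s0in s0S] : has (mem S) (rcons a1 z ++ b2).
      apply: sepS; case: a1 wv {uv ev eAv} => [|a a1] /= /and3P [h1 h2 h3];
      case: b1 ww {uw ew sBw} => [|b b1] /= /and3P [k1 k2 k3].
      - by rewrite k1 h2 k3.
      - by move: k1 k3; rewrite cat_path last_cat /= => /and3P [_ _ ->] ->; rewrite h2.
      - rewrite -cat_rcons cat_path in h1; case/andP: h1 => h1 _.
        by rewrite last_cat cat_path h1 last_rcons k1 h2 k3.
      - rewrite -cat_rcons cat_path in h1; case/andP: h1 => h1 _.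
        move: k1 k3; rewrite cat_path last_cat /= => /and3P [_ _ k1] k3.
        by rewrite last_cat cat_path h1 last_rcons k1 h2 k3.
    rewrite /= in s0S; have s0P : s0 \in x |: S by rewrite inE s0S orbT.
    have s0Q : s0 \in y |: S by rewrite inE s0S orbT.
    move: s0in; rewrite mem_cat => /orP [s0a|s0b].
      have es : s0 = v by apply: eAv => //; rewrite -cat_rcons mem_cat s0a.
      suff -> : z = s0 by [].
      rewrite es -ev last_cat /=; move: uv s0a; rewrite es -{1}ev last_cat /=.
      case/lastP: a2 {wv ev eAv} => // a2 l; rewrite !last_rcons -cat_rcons cat_uniq => /and3P [_ /hasPn dis _] lin.
      by have := dis l; rewrite mem_rcons inE eqxx /= lin => /(_ isT).
    have es : s0 = w by apply: sBw => //; rewrite mem_cat inE s0b !orbT.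
    suff -> : z = s0 by [].
    rewrite es -ew; move: uw s0b; rewrite es -{1}ew.
    case: b1 {ww ew sBw} => //= b b1 /andP [nb _] bin.
    by rewrite mem_cat inE bin !orbT in nb.
  pose L := enum S.
  (* Walks are joined at each vertex of [S], and the walk that ends at [x] is joined by the arc to
     the one that starts at [y]. *)
  exists (rcons [seq pa v ++ behead (pb v) | v <- L] (pa x ++ pb y)).
    by rewrite size_rcons size_map -cardE -sz1 -cx cardsU1 xS.
  have xP : x \in x |: S by apply: setU11.
  have yQ : y \in y |: S by apply: setU11.
  have SP v : v \in S -> v \in x |: S by move=> h; rewrite inE h orbT.
  have SQ v : v \in S -> v \in y |: S by move=> h; rewrite inE h orbT.
  split.
    rewrite all_rcons; apply/andP; split.
      have [m1 e1] := paP x xP; have [m2 e2] := pbP y yQ.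
      move: (walk1 _ m1) (walk2 _ m2) e1 e2; case: (pa x) => // a l; case: (pb y) => //= b m.
      move=> /and3P [h1 h2 h3] /and3P [k1 k2 k3] e1 e2; rewrite cat_path last_cat /= h2 k3 e1 e2 exy.
      by rewrite (sub_path sub h1) -e2 (sub_path sub k1).
    apply/allP => _ /mapP [v vL ->]; rewrite mem_enum in vL.
    have [m1 e1] := paP v (SP _ vL); have [m2 e2] := pbP v (SQ _ vL).
    move: (walk1 _ m1) (walk2 _ m2) e1 e2; case: (pa v) => // a l; case: (pb v) => //= b m.
    move=> /and3P [h1 h2 h3] /and3P [k1 k2 k3] e1 e2; rewrite cat_path last_cat /= h2 e1 -e2 k3.
    by rewrite (sub_path sub h1) (sub_path sub k1).
  have -> : uniq (flatten (rcons [seq pa v ++ behead (pb v) | v <- L] (pa x ++ pb y))) =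
      uniq (flatten [seq pa v | v <- x :: L] ++ (pb y ++ flatten [seq behead (pb v) | v <- L])).
    apply: perm_uniq; apply/seq.permP => f; rewrite -cats1 flatten_cat /= cats0 !count_cat.
    have -> : count f (flatten [seq pa v ++ behead (pb v) | v <- L]) =
       count f (flatten [seq pa v | v <- L]) + count f (flatten [seq behead (pb v) | v <- L]).
      by elim: (L) => //= v L' IHL; rewrite !count_cat IHL; clear; lia.
    move: (count f _) (count f _) (count f _) (count f _) => c1 c2 c3 c4.
    by rewrite addnACA [c1 + _]addnC [c2 + _]addnC.
  have uxL : uniq (x :: L) by rewrite /= mem_enum xS enum_uniq.
  have uyL : uniq (y :: L) by rewrite /= mem_enum yS enum_uniq.
  have mx v : v \in x :: L -> v \in x |: S by rewrite !inE mem_enum.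
  have my v : v \in y :: L -> v \in y |: S by rewrite !inE mem_enum.
  have u1 : uniq (flatten [seq pa v | v <- x :: L]).
    apply: (uniq_flatten_sub lk1.2).
      rewrite map_inj_in_uniq // => v w /mx vL /mx wL eq.
      by have [_ <-] := paP v vL; have [_ <-] := paP w wL; rewrite eq.
    by move=> _ /mapP [v /mx /paP [? _] ->].
  have u2 : uniq (flatten [seq pb v | v <- y :: L]).
    apply: (uniq_flatten_sub lk2.2).
      rewrite map_inj_in_uniq // => v w /my vL /my wL eq.
      by have [_ <-] := pbP v vL; have [_ <-] := pbP w wL; rewrite eq.
    by move=> _ /mapP [v /my /pbP [? _] ->].
  have u3 : uniq (pb y ++ flatten [seq behead (pb v) | v <- L]).
    apply: subseq_uniq u2; rewrite /= cat_subseq //.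
    elim: (L) => //= v L' IHL; apply: cat_subseq => //.
    by case: (pb v) => //= z m; apply: subseq_cons.
  rewrite cat_uniq u1 u3 andbT /=; apply/hasPn => z; rewrite mem_cat => zin.
  apply/negP => /= zf1; have {zf1} : z \in flatten [seq pa v | v <- x :: L] by [].
  case/flatten_mapP=> v /mx vP zv.
  move: zin => /orP [zy|zf].
    by have [zS _ ezy] := meet v y z vP yQ zv zy; rewrite -ezy zS in yS.
  have [w wL zw] : exists2 w, w \in L & z \in behead (pb w) by apply/flatten_mapP.
  rewrite mem_enum in wL; have zw' : z \in pb w by apply: mem_behead.
  have [_ _ ezw] := meet v w z vP (SQ _ wL) zv zw'; have [mw ew] := pbP w (SQ _ wL).
  have := uniq_flatten_mem lk2.2 mw; move: ew zw; case: (pb w) => //= b m ebw zm /andP [/negP nb _].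
  by apply: nb; rewrite ebw -ezw.
move/forallP: noe => noe.
have sepAB : separates e A B (A :&: B).
  case=> [|z [|w p]] //=; first by move=> /andP [zA zB]; rewrite inE zA zB.
  by rewrite (negbTE (noe (z, w))).
exists (take s [seq [:: z] | z <- enum (A :&: B)]).
  by rewrite size_takel // size_map -cardE sep.
split.
  apply/allP => p /mem_take /mapP [z]; rewrite mem_enum inE => /andP [zA zB] ->.
  by rewrite /= zA zB.
rewrite -map_take (_ : flatten _ = take s (enum (A :&: B))) ?take_uniq ?enum_uniq //.
by elim: (take _ _) => //= z l ->.
Qed.

End Menger.

(** * From disjoint paths to segments *)

Lemma count_take_leq (T : Type) (f : pred T) (s : seq T) m n :
  m <= n -> count f (take m s) <= count f (take n s).
Proof. by move=> mn; rewrite -(subnKC mn) takeD count_cat leq_addr. Qed.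

Lemma count_take_index (T : eqType) (f : pred T) (s : seq T) z n :
  z \in s -> f z -> index z s < n -> count f (take (index z s) s) < count f (take n s).
Proof.
move=> zs fz lt; apply: leq_trans (count_take_leq f s lt).
by rewrite (take_nth z) ?index_mem // nth_index // -cats1 count_cat /= fz addn1.
Qed.

(* A new segment starts after each vertex of [D] and after each [d] attachments. *)
Lemma segments (T K : finType) (x : K -> T) (C D : seq T) d :
  uniq C -> injective x -> (forall u, x u \in C) -> 0 < d ->
  exists a : K -> nat,
   [/\ forall u v, index (x u) C < index (x v) C -> a u <= a v,
       forall u v, a u = a v -> {in C, forall z,
         index (x u) C < index z C < index (x v) C -> z \notin D},
       forall v, #|[set u | a u == a v]| <= d &
       forall u, a u < (count (mem D) C + #|K| %/ d).+1].
Proof.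
move=> uC xI xC d0; pose c u := count (mem D) (take (index (x u) C) C).
pose rk u := count (mem (codom x)) (take (index (x u) C) C).
have cmono u v : index (x u) C <= index (x v) C -> c u <= c v by apply: count_take_leq.
have rmono u v : index (x u) C <= index (x v) C -> rk u %/ d <= rk v %/ d.
  by move=> h; apply: leq_div2r; apply: count_take_leq.
have rlt u v : index (x u) C < index (x v) C -> rk u < rk v.
  by apply: count_take_index; rewrite //= codom_f.
exists (fun u => c u + rk u %/ d); split.
- by move=> u v /ltnW h; apply: leq_add; [apply: cmono|apply: rmono].
- move=> u v euv z zC /andP [uz zv]; apply/negP => zD.
  have : c u < c v.
    apply: leq_ltn_trans (count_take_leq _ _ (ltnW uz)) _.
    exact: count_take_index.
  have := rmono u v (ltnW (ltn_trans uz zv)); move: euv.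
  by move: (c u) (c v) (_ %/ d) (_ %/ d); clear; lia.
(* Both summands are monotone along [C], so equal sums have equal summands; hence [rk] modulo [d] is
   injective on a segment. *)
- move=> v; have eq u : u \in [set u | c u + rk u %/ d == c v + rk v %/ d] -> rk u %/ d = rk v %/ d.
    rewrite inE => /eqP; have [h|h] := leqP (index (x u) C) (index (x v) C).
      move: (cmono u v h) (rmono u v h).
      by move: (c u) (c v) (_ %/ d) (_ %/ d); clear; lia.
    move: (cmono v u (ltnW h)) (rmono v u (ltnW h)).
    by move: (c u) (c v) (_ %/ d) (_ %/ d); clear; lia.
  rewrite -[leqRHS]card_ord; pose f u : 'I_d := Ordinal (ltn_pmod (rk u) d0).
  rewrite -(@card_in_imset _ _ f) ?max_card // => u w /eq eu /eq ew [emod].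
  have erk : rk u = rk w by rewrite (divn_eq (rk u) d) (divn_eq (rk w) d) emod eu ew.
  have [h|h|h] := ltngtP (index (x u) C) (index (x w) C).
  + by have := rlt _ _ h; rewrite erk ltnn.
  + by have := rlt _ _ h; rewrite erk ltnn.
  + by apply: xI; rewrite -(nth_index (x u) (xC u)) h nth_index.
- move=> u; rewrite ltnS leq_add //.
    have := count_cat (mem D) (take (index (x u) C) C) (drop (index (x u) C) C).
    by rewrite cat_take_drop => ->; apply: leq_addr.
  apply: leq_div2r; rewrite /rk -size_filter -(card_codom xI) cardE.
  apply: uniq_leq_size; first by rewrite filter_uniq // take_uniq.
  by move=> z; rewrite mem_filter mem_enum => /andP [].
Qed.

(** * Walks that meet the two cycles only at their ends *)

Section Trim.
Variables (T : finType) (e : rel T) (A B : {set T}).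

Definition proper_walk (p : seq T) :=
  [&& walk_between e A B p, ~~ has (mem A) (behead p) & ~~ has (mem B) (take (size p).-1 p)].

(** Restarting at a later vertex of [A], or stopping at an earlier vertex of [B], shortens the
    walk. *)
Lemma trim_walk p : walk_between e A B p -> exists2 p', subseq p' p & proper_walk p'.
Proof.
have [n] := ubnP (size p); elim: n p => // n IH [|x p] // le /and3P [pp xA lB].
have [/hasP [a ap aA]|nA] := boolP (has (mem A) p).
  case/splitPr: ap le pp lB => p1 p2 le pp0 lB0.
  have [pp lB] : path e a p2 /\ last a p2 \in B.
    by move: pp0 lB0; rewrite cat_path last_cat /= => /and3P [_ _ ->].
  have [||p' sub pr] := IH (a :: p2).
  - by move: le; rewrite /= size_cat /=; clear; lia.
  - by rewrite /= pp lB andbT.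
  by exists p' => //; apply: (subseq_trans sub); rewrite -cat_cons suffix_subseq.
have [/hasP [b bp bB]|nB] := boolP (has (mem B) (take (size p) (x :: p))); last first.
  by exists (x :: p); rewrite // /proper_walk /= pp xA lB nA.
rewrite -[x :: p]/(x :: p) lastI -cats1 take_size_cat ?size_belast // in bp.
have {}bB : b \in B := bB.
have ltb : (index b (x :: p)).+1 < size (x :: p).
  by rewrite lastI -cats1 index_cat bp size_cat /= addn1 ltnS index_mem.
have bxp : b \in x :: p by rewrite lastI mem_rcons inE bp orbT.
have [||p' sub pr] := IH (take (index b (x :: p)).+1 (x :: p)).
- by rewrite size_takel; [move: ltb le; rewrite /=; clear; lia | apply: ltnW].
- rewrite /= xA; move: ltb bxp => /=; case: eqP => [->|nxb] /=.
    by rewrite take0 /= bB.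
  rewrite ltnS => lt; rewrite inE => /predU1P [eb|bp'].
    by rewrite eb in nxb.
  rewrite (take_nth b) ?index_mem // nth_index // last_rcons bB andbT.
  by move: pp; rewrite -{1}(cat_take_drop (index b p).+1 p) (take_nth b) ?index_mem // nth_index // cat_path => /andP [].
by exists p' => //; apply: (subseq_trans sub); apply: take_subseq.
Qed.

Lemma trim_linkage ps : linkage e A B ps ->
  exists qs, [/\ size qs = size ps, all proper_walk qs & uniq (flatten qs)].
Proof.
case=> wps ups; suff [qs [sz pr sub]] : exists qs,
    [/\ size qs = size ps, all proper_walk qs & subseq (flatten qs) (flatten ps)].
  by exists qs; split=> //; apply: subseq_uniq sub ups.
elim: ps wps {ups} => [|p ps IH] /=; first by exists [::].
case/andP=> /trim_walk [p' sub pr] /IH [qs [sz prs subs]].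
by exists (p' :: qs); rewrite /= sz pr prs cat_subseq.
Qed.

End Trim.

(** The part of [crossing] that concerns the paths, before the cycles are cut into segments. *)
Record connectors (T K : finType) (e : rel T) (C D : seq T) (x y : K -> T) (P : K -> seq T) :
  Prop := Connectors {
    co_x : forall u, (x u \in C) && (x u \notin D);
    co_y : forall u, (y u \in D) && (y u \notin C);
    co_P : forall u, path e (x u) (rcons (P u) (y u));
    co_PCD : forall u, {in P u, forall z, (z \notin C) && (z \notin D)};
    co_uP : forall L, uniq L -> uniq (flatten (map P L));
    co_xI : injective x; co_yI : injective y }.

(** A trimmed walk with a single vertex uses up a common vertex of the cycles; the longer ones,
    split into their ends and interiors, are the connectors. *)
Lemma linkage_connectors (T : finType) (e : rel T) (C D : seq T) ps :
  linkage e [set z in C] [set z in D] ps ->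
  exists r (x y : 'I_r -> T) (P : 'I_r -> seq T),
    connectors e C D x y P /\ size ps <= count (mem D) C + r.
Proof.
move=> /trim_linkage [qs0 [<- pr0 u0]].
pose qs := [seq p <- qs0 | 1 < size p]; exists (size qs).
have sub0 : {subset qs <= qs0} by apply: mem_subseq; apply: filter_subseq.
have uq0 : uniq qs0.
  elim: (qs0) pr0 u0 => //= p l IH /andP [pr prl]; rewrite cat_uniq => /and3P [_ /hasPn dis ul].
  rewrite IH // andbT; apply/negP => pl; case: p pr pl dis => // z p _ pl dis.
  have /dis : z \in flatten l by apply/flattenP; exists (z :: p); rewrite ?mem_head.
  by rewrite /= mem_head.
have uq : uniq qs by apply: filter_uniq.
have ufq : uniq (flatten qs) by apply: uniq_flatten_sub u0 uq sub0.
have qin (i : 'I_(size qs)) : nth [::] qs i \in qs by apply: mem_nth.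
have [f fP] : exists f : 'I_(size qs) -> T * seq T * T, forall i : 'I_(size qs),
    nth [::] qs i = (f i).1.1 :: rcons (f i).1.2 (f i).2.
  suff /fin_all_exists : forall i : 'I_(size qs), exists u : T * seq T * T,
    nth [::] qs i = u.1.1 :: rcons u.1.2 u.2 by [].
  move=> i; have := qin i; rewrite mem_filter => /andP [].
  case: (nth [::] qs i) => [|z p] //=; case/lastP: p => // p w _ _.
  by exists (z, p, w).
have nthI (i j : 'I_(size qs)) z : z \in nth [::] qs i -> z \in nth [::] qs j -> i = j.
  move=> zi zj; have /eqP := mem_uniq_flatten ufq (qin i) (qin j) zi zj.
  by rewrite nth_uniq // => /eqP /val_inj.
have prop i : let: (x, p, y) := f i in [/\ path e x (rcons p y), x \in C, y \in D,
    {in rcons p y, forall z, z \notin C} & {in x :: p, forall z, z \notin D}].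
  have := allP pr0 _ (sub0 _ (qin i)); rewrite fP; case: (f i) => [[x p] y] /=.
  rewrite /proper_walk /= size_rcons => /and3P [/and3P [pp xC]].
  rewrite last_rcons !inE in xC * => yD /hasPn nC /hasPn nD; split=> //.
  - by move=> z /nC; rewrite /= inE.
  - move=> z zp; have := nD z; rewrite -cats1 /= take_size_cat // => /(_ zp).
    by rewrite /= inE.
exists (fun i => (f i).1.1), (fun i => (f i).2), (fun i => (f i).1.2); split.
  split.
  - by move=> i; have := prop i; case: (f i) => [[x p] y] [_ -> _ _ /(_ x)]; rewrite mem_head => ->.
  - move=> i; have := prop i; case: (f i) => [[x p] y] [_ _ -> /(_ y) + _].
    by rewrite mem_rcons mem_head => ->.
  - by move=> i; have := prop i; case: (f i) => [[x p] y] [].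
  - move=> i; have := prop i; case: (f i) => [[x p] y] [_ _ _ h1 h2] z /= zp.
    by rewrite h1 ?h2 // ?mem_rcons inE zp orbT.
  - move=> L uL; have : uniq (flatten [seq nth [::] qs (i : 'I__) | i <- L]).
      apply: uniq_flatten_sub ufq _ _; last by move=> _ /mapP [i _ ->].
      by rewrite map_inj_uniq // => i j /eqP; rewrite nth_uniq // => /eqP /val_inj.
    apply: subseq_uniq; elim: (L) => //= i l IH; apply: cat_subseq => //.
    by rewrite fP; apply: subseq_trans (subseq_cons _ _); apply: subseq_rcons.
  - by move=> i j eq; apply: (nthI i j (f i).1.1); rewrite fP ?mem_head // eq mem_head.
  - by move=> i j eq; apply: (nthI i j (f i).2); rewrite fP inE mem_rcons inE ?eq eqxx orbT.
rewrite -(count_predC (fun p : seq T => 1 < size p) qs0) size_filter addnC leq_add2r -size_filter -[leqRHS]size_filter.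
set qs1 := [seq p <- qs0 | _].
have u1 : uniq (flatten qs1).
  by apply: uniq_flatten_sub u0 (filter_uniq _ uq0) _; apply: mem_subseq; apply: filter_subseq.
have q1P p : p \in qs1 -> exists z, [/\ p = [:: z], z \in C & z \in D].
  rewrite mem_filter => /andP [sz /(allP pr0)]; case: p sz => [|z [|w p]] //= _.
  by rewrite /proper_walk /= !inE => /andP [/andP [zC zD] _]; exists z.
have -> : size qs1 = size (flatten qs1).
  elim: (qs1) q1P => //= p l IH h; have [z [-> _ _]] := h p (mem_head _ _).
  by rewrite /= IH // => q ql; apply: h; rewrite inE ql orbT.
apply: uniq_leq_size => // z /flattenP [p /q1P [w [-> wC wD]]].
by rewrite inE => /eqP ->; rewrite mem_filter /= wD.
Qed.

(** The factor [d * k] is bounded by [r] and cancelled, which leaves [r ^ 2 <= c * (k ^ 3 * t)];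
    this is cubed, [t ^ 3] is replaced by [8 * d], and [d * k] is cancelled once more. *)
Lemma exponent_arith (c r k d t : nat) : 0 < r -> d * k <= r -> t ^ 3 <= 8 * d ->
  r ^ 3 <= c * (k ^ 4 * (d * t)) -> r ^ 5 <= 8 * c ^ 3 * k ^ 8.
Proof.
move=> r0 dk t3 h.
have h2 : r ^ 2 <= c * (k ^ 3 * t).
  rewrite -(leq_pmul2l r0) -expnS; apply: leq_trans h _.
  have -> : c * (k ^ 4 * (d * t)) = d * k * (c * (k ^ 3 * t)).
    by rewrite expnS; move: (k ^ 3) => m; ring.
  by rewrite leq_mul2r dk orbT.
rewrite -(leq_pmul2l r0) -expnS.
have -> : r ^ 6 = (r ^ 2) ^ 3 by rewrite -expnM.
apply: leq_trans (_ : (c * (k ^ 3 * t)) ^ 3 <= _); first by rewrite leq_exp2r.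
have -> : (c * (k ^ 3 * t)) ^ 3 = c ^ 3 * (k ^ 9 * t ^ 3) by rewrite expnMn [X in _ * X = _]expnMn -expnM.
apply: leq_trans (_ : c ^ 3 * (k ^ 9 * (8 * d)) <= _); first by rewrite !leq_mul2l t3 !orbT.
have -> : c ^ 3 * (k ^ 9 * (8 * d)) = d * k * (8 * c ^ 3 * k ^ 8).
  by rewrite [k ^ 9]expnS; move: (k ^ 8) (c ^ 3) => m n; ring.
by rewrite leq_mul2r dk orbT.
Qed.

Section TwoLongestCycles.
Variables (T : finType) (e : rel T).
Hypothesis e_sym : symmetric e.
Variables (C D : seq T).
Hypothesis uC : uniq C.
Hypothesis uD : uniq D.
Hypothesis cC : path.cycle e C.
Hypothesis cD : path.cycle e D.
Hypothesis maxC : forall Z, uniq Z -> path.cycle e Z -> size Z <= size C.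
Hypothesis sizeD : size D = size C.

Lemma connectors_crossing (K : finType) (x y : K -> T) (P : K -> seq T) (a b : K -> nat) :
  connectors e C D x y P ->
  (forall u v, index (x u) C < index (x v) C -> a u <= a v) ->
  (forall u v, index (y u) D < index (y v) D -> b u <= b v) ->
  (forall u v, a u = a v -> {in C, forall z,
      index (x u) C < index z C < index (x v) C -> z \notin D}) ->
  (forall u v, b u = b v -> {in D, forall z,
      index (y u) D < index z D < index (y v) D -> z \notin C}) ->
  crossing e C D x y P a b.
Proof. by case. Qed.

(** If the cycles were disjoint, each could be taken as a single segment, and two paths would form a
    double edge. *)
Lemma longest_cycles_meet ps : linkage e [set z in C] [set z in D] ps -> 1 < size ps ->
  0 < count (mem D) C.
Proof.
move=> /linkage_connectors [r [x [y [P [co le]]]]] sz; rewrite lt0n; apply/eqP => k0.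
have disj z : z \in C -> z \notin D.
  by move=> zC; apply/negP => zD; move/eqP: k0; rewrite eqn0Ngt -has_count => /hasPn /(_ z zC) /negP.
have cr : crossing e C D x y P (fun=> 0) (fun=> 0).
  apply: connectors_crossing => // u v _ z zC _; first exact: disj.
  by apply: contraL zC; apply: disj.
rewrite k0 add0n in le; have r2 := leq_trans sz le.
have := crossing_simple e_sym cr (u := Ordinal (ltnW r2)) (v := Ordinal r2) erefl erefl.
by case.
Qed.

(** The factor [4 ^ 4 * 50] comes from at most [4 * k] segments and from
    [48 * (d * t) + 2 * d <= 50 * (d * t)]; [2 ^ 5] comes from bounding [size ps <= k + r] by twice
    the larger of [k] and [r]. [M] enters through an equation so that this huge unary number is not
    evaluated. *)
Lemma linkage_bound (M : nat) ps : M = 2 ^ 5 * (8 * (4 ^ 4 * 50) ^ 3) + 2 ^ 5 ->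
  0 < count (mem D) C -> linkage e [set z in C] [set z in D] ps ->
  size ps ^ 5 <= M * count (mem D) C ^ 8.
Proof.
have [c0 c0E] : exists c, c = 4 ^ 4 * 50 by exists (4 ^ 4 * 50).
rewrite -c0E => -> ; set k := count _ _ => k0.
move=> /linkage_connectors [r [x [y [P [co le]]]]]; rewrite -/k in le.
have kD : count (mem C) D = k.
  rewrite /k -!size_filter; apply: perm_size; apply: uniq_perm; rewrite ?filter_uniq //.
  by move=> z; rewrite !mem_filter andbC.
have [rk|kr] := leqP r k.
  apply: leq_trans (_ : (2 * k) ^ 5 <= _).
    by rewrite leq_exp2r // (leq_trans le) // mul2n -addnn leq_add2l.
  by rewrite expnMn; apply: leq_mul; [apply: leq_addl | apply: leq_pexp2l].
have r0 : 0 < r by apply: leq_trans kr.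
(* With about [r / k] attachments to a segment, the number of segments stays linear in [k]. *)
have [d dE] : exists d, d = r %/ k by exists (r %/ k).
have d0 : 0 < d by rewrite dE divn_gt0 // ltnW.
have dk : d * k <= r by rewrite dE leq_divM.
have rd : r %/ d < 2 * k.
  rewrite ltn_divLR //; have := ltn_ceil r k0; rewrite -dE.
  move/leq_trans; apply; rewrite mulSn -mulnA mulnCA mul2n -addnn mulnDr mulnC.
  by rewrite [k * d]mulnC leq_add2r leq_pmull.
(* The least [t] with [d <= t ^ 3]; if [t > 1], then [(t - 1) ^ 3 < d] and [t <= 2 * (t - 1)]. *)
have [t [dt t8]] : exists t, d <= t ^ 3 /\ t ^ 3 <= 8 * d.
  have ex : exists t, d <= t ^ 3 by exists d; apply: leq_trans (leq_pexp2l d0 (isT : 1 <= 3)).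
  exists (ex_minn ex); case: ex_minnP => t dt tmin; split=> //.
  case: t dt tmin => [|[|t]] dt tmin; first by rewrite exp0n.
    by rewrite exp1n muln_gt0.
  have : t.+1 ^ 3 < d by rewrite ltnNge; apply/negP => /tmin; rewrite ltnn.
  move/ltnW => h; apply: leq_trans (_ : 8 * t.+1 ^ 3 <= _); last by rewrite leq_mul2l h.
  by rewrite (_ : 8 = 2 ^ 3) // -expnMn leq_exp2r // mul2n -addnn addSn ltnS leq_addl.
have xC u : x u \in C by case/andP: (co_x co u).
have yD u : y u \in D by case/andP: (co_y co u).
have [a [am ai ad aN]] := segments D uC (co_xI co) xC d0.
have [b [bm bi bd bN]] := segments C uD (co_yI co) yD d0.
rewrite kD card_ord in bN; rewrite -/k card_ord in aN.
have cr := connectors_crossing co am bm ai bi.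
have := crossing_bound e_sym cr aN bN ad bd dt; rewrite card_ord => bnd.
have t0 : 0 < t by case: (t) dt d0 => //; rewrite exp0n // leqn0 => /eqP ->.
have r3 : r ^ 3 <= c0 * (k ^ 4 * (d * t)).
  apply: leq_trans bnd _; rewrite c0E.
  have -> : 4 ^ 4 * 50 * (k ^ 4 * (d * t)) = (4 * k) ^ 4 * (50 * (d * t)).
    by rewrite expnMn; move: (4 ^ 4) (k ^ 4) (d * t) => p q s; rewrite mulnACA.
  apply: leq_mul.
    rewrite leq_exp2r //; move: rd k0; move: (r %/ d) => m; clear; lia.
  rewrite -[50]/(48 + 2) mulnDl leq_add2l leq_mul2l /=.
  by rewrite leq_pmulr.
apply: leq_trans (_ : (2 * r) ^ 5 <= _).
  by rewrite leq_exp2r // (leq_trans le) // mul2n -addnn leq_add2r ltnW.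
rewrite expnMn; apply: leq_trans (_ : 2 ^ 5 * (8 * c0 ^ 3 * k ^ 8) <= _).
  by rewrite leq_mul2l (exponent_arith r0 dk t8 r3) orbT.
by rewrite mulnA leq_mul2r leq_addr orbT.
Qed.

End TwoLongestCycles.

(** * Vertex-transitive graphs *)

Section VertexTransitive.
Variables (T : finType) (e : rel T).
Hypothesis e_simple : simple_graph e.
Hypothesis e_conn : connected_graph e.
Hypothesis e_trans : vertex_transitive e.
Hypothesis cT : 3 <= #|T|.

Let e_sym : symmetric e := e_simple.1.

(** The deleted vertex remains in the type as an isolated vertex. *)
Definition delete (v : T) : rel T := fun x y => [&& e x y, x != v & y != v].

Lemma delete_sym v : connect_sym (delete v).
Proof. by apply: sym_connect_sym => x y; rewrite /delete e_sym [(x != v) && _]andbC. Qed.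

Lemma exists_neighbour x : exists y, e x y.
Proof.
have [y nyx] : exists y, y != x.
  have : 0 < #|[set~ x]| by rewrite cardsC1; case: #|T| cT => // -[].
  by case/card_gt0P=> y; rewrite !inE; exists y.
have /connectP [[|z p] /= pp ey] := e_conn x y; first by rewrite ey eqxx in nyx.
by case/andP: pp => exz _; exists z.
Qed.

Lemma connect_delete_to v x y : connect e x y -> x != v -> y = v ->
  exists2 z, connect (delete v) x z & e z v.
Proof.
case/connectP=> p; elim: p x => [|w p IH] x /= pp ey nx eyv.
  by rewrite -ey eyv eqxx in nx.
case/andP: pp => exw pp; have [ewv|nw] := eqVneq w v.
  by exists x; [apply: connect0 | rewrite -ewv].
have [z cz ez] := IH w pp ey nw eyv; exists z => //; apply: connect_trans cz.
by apply: connect1; rewrite /delete exw nx.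
Qed.

(* Take [v] and a component of the graph without [v] of maximal size: a vertex
   [y] outside it would give a larger component in the graph without [y]. *)
Lemma exists_non_cut : exists v, forall x y, x != v -> y != v -> connect (delete v) x y.
Proof.
have [v0 _] : exists v : T, v \in T by apply/card_gt0P; apply: leq_trans cT.
have [w0 nw0] : exists y, e v0 y := exists_neighbour v0.
have P0 : (fun vx : T * T => vx.1 != vx.2) (v0, w0).
  by apply: contraTneq nw0 => /= ->; rewrite e_simple.2.
case: (@arg_maxnP _ (v0, w0) (fun vx : T * T => vx.1 != vx.2)
  (fun vx => #|connect (delete vx.1) vx.2|) P0) => -[v x] /= nvx mx.
have all y : y != v -> connect (delete v) x y.
  move=> nyv; apply/negPn/negP => nc.
  have nxy : y != x by apply: contraNneq nc => ->; apply: connect0.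
  have /= := mx (y, x) nxy; rewrite leqNgt => /negP; apply.
  have sub z : connect (delete v) x z -> connect (delete y) x z.
    case/connectP=> p pp ->.
    have nin : y \notin x :: p.
      apply: contra nc => yin; move: pp; case/splitPl: yin => p1 p2 <-; rewrite cat_path => /andP [p1p _].
      by apply/connectP; exists p1.
    apply/connectP; exists p => //; elim: p x {nc nxy mx nvx P0} pp nin => //= w p IH z'.
    case/andP=> /and3P [ezw _ _] pp; rewrite !inE !negb_or => /and3P [h1 h2 h3].
    by rewrite /delete ezw eq_sym h1 eq_sym h2 /= IH // inE negb_or h2.
  have nxv : x != v by rewrite eq_sym.
  have [z cz ezv] := connect_delete_to (e_conn x v) nxv erefl.
  apply: proper_card; apply/properP; split; first by apply/subsetP => w; apply: sub.
  (* The larger component gains [v], which is adjacent to the old component and differs from [y]. *)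
  exists v.
    apply: connect_trans (sub _ cz) _; apply: connect1; rewrite /delete ezv [v == y]eq_sym nyv andbT /=.
    by apply: contraNneq nc => <-.
  have nend p w : w != v -> path (delete v) w p -> last w p != v.
    by elim: p w => //= w' p IH w _ /andP [/and3P [_ _ h] /(IH _ h)].
  apply/negP; rewrite unfold_in /= => /connectP [p pp ev].
  by have := nend p x nxv pp; rewrite -ev eqxx.
exists v => x' y nx ny; apply: connect_trans (all y ny).
by rewrite delete_sym; apply: all.
Qed.

Lemma no_cut_vertex v x y : x != v -> y != v -> connect (delete v) x y.
Proof.
have [u uP] := exists_non_cut; have [g [ge gu]] := e_trans u v.
move=> nx ny; have ginv w : w != v -> (g^-1)%g w != u.
  by apply: contraNneq => h; rewrite -gu -h permKV.
have /connectP [p pp ey] := uP _ _ (ginv x nx) (ginv y ny).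
apply/connectP; exists (map g p); last by rewrite -[x in last x _](permKV g) last_map -ey permKV.
rewrite -[x](permKV g) path_map; apply: sub_path pp => a b /and3P [eab na nb].
by rewrite /delete /= ge eab -gu !(inj_eq perm_inj) na nb.
Qed.

(** A vertex [x] has two neighbours, since a single one would be a cut vertex; a path between them
    that avoids [x] closes to a cycle. *)
Lemma exists_cycle : exists p, graph_cycle e p.
Proof.
have [x _] : exists v : T, v \in T by apply/card_gt0P; apply: leq_trans cT.
have [y exy] := exists_neighbour x.
have nxy : x != y by apply: contraTneq exy => ->; rewrite e_simple.2.
have [z exz nzy] : exists2 z, e x z & z != y.
  have [w] : exists w, w \in ~: [set x; y].
    by apply/card_gt0P; rewrite cardsCs setCK cards2 nxy subn_gt0.
  rewrite !inE negb_or => /andP [nwx nwy].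
  have /connectP [[|z p] /= pp ew] := no_cut_vertex nxy nwy; first by rewrite ew eqxx in nwx.
  by case/andP: pp => /and3P [exz _ nz] _; exists z.
have nzx : z != x by apply: contraTneq exz => ->; rewrite e_simple.2.
rewrite eq_sym in nxy; have /connectP [p pp ez] := no_cut_vertex nxy nzx.
move: pp ez.
case/shortenP=> q qq uq _ ez; exists (x :: y :: q).
have qx : x \notin y :: q.
  elim: q y {exy nzy uq ez} nxy qq => [|w q IH] y' n; first by rewrite !inE eq_sym.
  by move=> /= /andP [/and3P [_ _ nw] /(IH _ nw)]; rewrite !inE !negb_or [x == y']eq_sym n.
have eq : path e y q by apply: sub_path qq => a b /and3P [].
split; first by rewrite /ucycle /= exy rcons_path eq -ez e_sym exz andbT /=; rewrite qx.
by case: q ez {qq uq qx eq} => //= ezy; rewrite ezy eqxx in nzy.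
Qed.

Definition longest_cycle (C : seq T) :=
  [/\ uniq C, path.cycle e C, 3 <= size C &
      forall Z, uniq Z -> path.cycle e Z -> size Z <= size C].

Lemma exists_longest_cycle : exists C, longest_cycle C.
Proof.
have [p [/andP [cp up] sp]] := exists_cycle.
pose Q n := [exists Z : n.-tuple T, path.cycle e Z && uniq Z].
have QP Z : uniq Z -> path.cycle e Z -> Q (size Z).
  by move=> uZ cZ; apply/existsP; exists (in_tuple Z); rewrite cZ.
have ex : exists n, Q n by exists (size p); apply: QP.
have bnd n : Q n -> n <= #|T|.
  by case/existsP=> Z /andP [_ uZ]; rewrite -(size_tuple Z) -(card_uniqP uZ) max_card.
case: (ex_maxnP ex bnd) => m /existsP [Z /andP [cZ uZ]] mm; exists Z; split=> //.
  by rewrite size_tuple; apply: leq_trans sp (mm _ (QP _ up cp)).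
by move=> Y uY cY; rewrite size_tuple; apply: mm; apply: QP.
Qed.

Lemma longest_cycle_map C g : graph_automorphism e g -> longest_cycle C -> longest_cycle (map g C).
Proof.
move=> ge [uC cC sC mC]; split; rewrite ?size_map // ?(map_inj_uniq perm_inj) //.
by rewrite (homo_cycle (e := e)) // => a b; rewrite ge.
Qed.

(** One vertex does not separate the cycles, as there are no cut vertices; so Menger's theorem gives
    two disjoint paths and [longest_cycles_meet] applies. *)
Lemma longest_cycles_intersect C D : longest_cycle C -> longest_cycle D ->
  exists2 z, z \in C & z \in D.
Proof.
move=> [uC cC sC mC] [uD cD sD mD].
have sz : size D = size C by apply/eqP; rewrite eqn_leq mC // mD.
suff /hasP [z zC zD] : has (mem D) C by exists z.
rewrite has_count; have [|ps sps lk] := @menger T e [set z in C] [set z in D] 2.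
  move=> S sep; rewrite ltnNge; apply/negP => cS.
  have avoid (Z : seq T) v : uniq Z -> 3 <= size Z -> exists2 z, z \in Z & z != v.
    case: Z => [|z [|w Z]] //= /andP [nz _] _; have [ez|nzv] := eqVneq z v; last first.
      by exists z; rewrite ?mem_head.
    by exists w; rewrite ?inE ?eqxx ?orbT // -ez; apply: contraNneq nz => ->; rewrite mem_head.
  have [v vS] : exists v, S \subset [set v].
    have [->|[v vS]] := set_0Vmem S; first by case: (C) sC => // v *; exists v; apply: sub0set.
    exists v; apply/subsetP => w wS; rewrite inE.
    by apply/eqP; apply: (card_le1_eqP cS).
  have [x xC nx] := avoid C v uC sC; have [y yD ny] := avoid D v uD sD.
  have /connectP [p pp ey] := no_cut_vertex nx ny.
  have /hasP [w wp wS] : has (mem S) (x :: p).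
    by apply: sep; rewrite /= !inE xC -ey yD (sub_path _ pp) // => a b /and3P [].
  have /eqP ew : w == v by rewrite -in_set1; apply: (subsetP vS).
  elim: p x nx pp wp {xC ey} => [|z p IH] x nx /=; first by rewrite inE ew eq_sym (negbTE nx).
  by move=> /andP [/and3P [_ _ nz] pp]; rewrite inE ew eq_sym (negbTE nx) /= -ew; apply: IH.
by apply: (longest_cycles_meet e_sym uC uD cC cD mC sz lk); rewrite sps.
Qed.

(** * Averaging over the automorphism group *)

Definition automorphisms : {set {perm T}} :=
  [set g : {perm T} | [forall x, forall y, e (g x) (g y) == e x y]].

Lemma automorphismsP g : reflect (graph_automorphism e g) (g \in automorphisms).
Proof.
rewrite inE; apply: (iffP forallP) => [h x y|h x]; first by have /forallP /(_ y) /eqP := h x.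
by apply/forallP => y; rewrite h.
Qed.

(** Composition with an automorphism that takes [z] to [w] injects the automorphisms with [g x = z]
    into those with [g x = w], so all these classes have the same size. *)
Lemma card_automorphisms_to x y :
  #|[set g in automorphisms | g x == y]| * #|T| = #|automorphisms|.
Proof.
have le z w : #|[set g in automorphisms | g x == z]| <= #|[set g in automorphisms | g x == w]|.
  have [h [he hz]] := e_trans z w.
  rewrite -(card_imset _ (mulIg h)); apply: subset_leq_card; apply/subsetP => _ /imsetP [g + ->].
  rewrite !in_set => /andP [/forallP gP /eqP gx]; rewrite permM gx hz eqxx andbT.
  apply/forallP => u; apply/forallP => v; rewrite !permM he.
  by have /forallP := gP u.
rewrite -[RHS]sum1_card (partition_big (fun g : {perm T} => g x) predT) //=.
rewrite (eq_bigr (fun=> #|[set g in automorphisms | g x == y]|)).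
  by rewrite sum_nat_const mulnC.
by move=> z _; rewrite sum1dep_card; apply/eqP; rewrite eqn_leq !le.
Qed.

Lemma sum_automorphisms (X Y : {set T}) :
  (\sum_(g in automorphisms) #|[set x in X | g x \in Y]|) * #|T| = #|X| * #|Y| * #|automorphisms|.
Proof.
have -> : \sum_(g in automorphisms) #|[set x in X | g x \in Y]| =
    \sum_(x in X) \sum_(y in Y) #|[set g in automorphisms | g x == y]|.
  rewrite (eq_bigr (fun g : {perm T} => \sum_(x in X) (g x \in Y))); last first.
    move=> g _; rewrite -sum1dep_card big_mkcondr /=.
    by apply: eq_bigr => x _; case: (g x \in Y).
  rewrite exchange_big /=; apply: eq_bigr => x _.
  rewrite (eq_bigr (fun y => \sum_(g in automorphisms) (g x == y))); last first.
    move=> y _; rewrite -sum1dep_card big_mkcondr /=.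
    by apply: eq_bigr => g _; case: (g x == y).
  rewrite exchange_big /=; apply: eq_bigr => g _.
  have [gY|gY] := boolP (g x \in Y).
    rewrite (bigD1 (g x)) //= eqxx big1 ?addn0 // => y /andP [_ ny].
    by rewrite eq_sym (negbTE ny).
  by rewrite big1 // => y yY; case: eqP gY => // ->; rewrite yY.
rewrite big_distrl /= (eq_bigr (fun=> #|Y| * #|automorphisms|)) => [|x _].
  by rewrite sum_nat_const mulnA.
rewrite big_distrl /= (eq_bigr (fun=> #|automorphisms|)) ?sum_nat_const // => y _.
exact: card_automorphisms_to.
Qed.

(** By [sum_automorphisms], the mean of the left-hand side over all automorphisms is
    [#|X| * #|Y|]. *)
Lemma few_meetings (X Y : {set T}) : exists2 g, graph_automorphism e g &
  #|[set x in X | g x \in Y]| * #|T| <= #|X| * #|Y|.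
Proof.
have id_aut : (1%g : {perm T}) \in automorphisms by apply/automorphismsP => x y; rewrite !perm1.
have [/exists_inP [g /automorphismsP gA le]|/exists_inPn h] := boolP [exists (g | g \in automorphisms),
    #|[set x in X | g x \in Y]| * #|T| <= #|X| * #|Y|]; first by exists g.
have : #|automorphisms| * (#|X| * #|Y|).+1 <= #|X| * #|Y| * #|automorphisms|.
  rewrite -sum_automorphisms -sum_nat_const big_distrl /=; apply: leq_sum => g /h.
  by rewrite -ltnNge.
by rewrite mulnC leq_mul2r ltnn orbF => /eqP /cards0_eq a0; rewrite a0 inE in id_aut.
Qed.

Lemma longest_cycle_bound C (M : nat) : M = 2 ^ 5 * (8 * (4 ^ 4 * 50) ^ 3) + 2 ^ 5 ->
  longest_cycle C -> #|T| ^ 13 <= M * size C ^ 21.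
Proof.
move=> eM lC; have [uC cC sC mC] := lC.
have cardC : #|[set z in C]| = size C by rewrite cardsE; apply/card_uniqP.
have [g gA few] := few_meetings [set z in C] [set z in C].
have lD := longest_cycle_map gA lC; have [uD cD _ _] := lD.
have sD : size C = size (map g C) by rewrite size_map.
pose k := count (mem C) (map g C).
have kn : k * #|T| <= size C ^ 2.
  rewrite -mulnn -{1 2}cardC; apply: leq_trans few; rewrite leq_mul2r /k count_map.
  apply/orP; right; rewrite -size_filter -(card_uniqP (filter_uniq _ uC)).
  by apply: subset_leq_card; apply/subsetP => z; rewrite mem_filter !inE /= => /andP [-> ->].
have k0 : 0 < k.
  have [z zD zC] := longest_cycles_intersect lD lC.
  by rewrite /k -has_count; apply/hasP; exists z.
have l0 : 0 < size C by apply: leq_trans sC.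
have sepS S : separates e [set z in map g C] [set z in C] S -> #|T| <= #|S| * size C.
  move=> sep; rewrite leqNgt; apply/negP => lt.
  (* A translate of [C] that misses [S] meets both cycles, hence connects them. *)
  have [h hA hS] := few_meetings [set z in C] S.
  have dis z : z \in map h C -> z \notin S.
    case/mapP=> w wC ->; apply/negP => wS.
    have : 0 < #|[set x in [set z in C] | h x \in S]|.
      by apply/card_gt0P; exists w; rewrite !inE wC.
    rewrite -(leq_pmul2r (ltnW (ltnW cT))) => /leq_trans /(_ hS).
    by rewrite mul1n cardC mulnC leqNgt lt.
  have lH := longest_cycle_map hA lC; have [uH cH _ _] := lH.
  have [z zH zD] := longest_cycles_intersect lH lD.
  have [w wH wC] := longest_cycles_intersect lH lC.
  have [i q eq] := rot_to zH.
  have wq : w \in z :: q by rewrite -eq mem_rot.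
  have zq : path e z q.
    by move: cH; rewrite -(rot_cycle i) eq /= rcons_path => /andP [].
  have qH : {subset z :: q <= map h C} by move=> u; rewrite -eq mem_rot.
  case/splitPl: wq zq qH => q1 q2 lq; rewrite cat_path => /andP [zq _] qH.
  have : has (mem S) (z :: q1) by apply: sep; rewrite /= zq !inE zD lq wC.
  case/hasP=> u uq; apply/negP; apply: dis; apply: qH.
  by rewrite -cat_cons mem_cat uq.
have T0 : 0 < #|T| by apply: leq_trans cT.
(* The quotient of [#|T|] by [size C], rounded up. *)
pose s := (#|T|.-1 %/ size C).+1.
have [|ps sps lk] := @menger T e [set z in map g C] [set z in C] s.
  by move=> S /sepS; rewrite /s ltn_divLR // -ltnS prednK.
have ns : #|T| <= s * size C by rewrite -[X in X <= _](prednK T0) ltn_ceil.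
have mD Z : uniq Z -> path.cycle e Z -> size Z <= size (map g C) by rewrite size_map; apply: mC.
have := linkage_bound e_sym uD uC cD cC mD sD eM k0 lk; rewrite sps -/k => bnd.
(* With [n = #|T|] and [l = size C]: [n ^ 13 <= (s * l) ^ 5 * n ^ 8 <= M * l ^ 5 * (k * n) ^ 8 <= M
   * l ^ 21]. *)
rewrite -[13]/(5 + 8) expnD; apply: leq_trans (_ : (s * size C) ^ 5 * #|T| ^ 8 <= _).
  by rewrite leq_mul2r leq_exp2r // ns orbT.
apply: leq_trans (_ : M * k ^ 8 * (size C ^ 5 * #|T| ^ 8) <= _).
  by rewrite expnMn -mulnA leq_mul2r bnd orbT.
have -> : M * k ^ 8 * (size C ^ 5 * #|T| ^ 8) = M * (size C ^ 5 * (k * #|T|) ^ 8).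
  by rewrite expnMn; move: (k ^ 8) (size C ^ 5) (#|T| ^ 8) => a b c; rewrite -mulnA [a * _]mulnCA.
rewrite -[21]/(5 + 2 * 8) expnD expnM !leq_mul2l.
by rewrite leq_exp2r // kn !orbT.
Qed.

End VertexTransitive.

(** * Passage to real powers *)

Import Order.TTheory GRing.Theory Num.Theory.
Local Open Scope ring_scope.

Lemma root21_bound (R : realType) (n l M : nat) : (0 < M)%N -> (n ^ 13 <= M * l ^ 21)%N ->
  (M%:R `^ 21^-1)^-1 * (n%:R `^ (13%:R / 21%:R)) <= l%:R :> R.
Proof.
move=> M0 h; have Mp : 0 < (M%:R : R) `^ 21^-1 by apply: powR_gt0; rewrite ltr0n.
rewrite mulrC ler_pdivrMr // powRrM powR_mulrn ?ler0n // -natrX.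
apply: le_trans (_ : ((M * l ^ 21)%N%:R : R) `^ 21%:R^-1 <= _).
  by apply: ge0_ler_powR; rewrite ?invr_ge0 ?nnegrE ?ler0n ?ler_nat.
rewrite natrM powRM ?ler0n // mulrC natrX -powR_mulrn ?ler0n // -powRrM divff ?pnatr_eq0 //.
by rewrite powRr1 ?ler0n.
Qed.

Theorem theorem1p1 (R : realType) :
  exists2 c : R, 0 < c &
    forall (T : finType) (e : rel T),
      simple_graph e -> connected_graph e -> vertex_transitive e ->
      (3 <= #|T|)%N ->
      exists2 p : seq T, graph_cycle e p &
        c * (#|T|%:R `^ (13%:R / 21%:R)) <= (size p)%:R.
Proof.
have [M eM] : exists M, M = (2 ^ 5 * (8 * (4 ^ 4 * 50) ^ 3) + 2 ^ 5)%N.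
  by exists (2 ^ 5 * (8 * (4 ^ 4 * 50) ^ 3) + 2 ^ 5)%N.
have M0 : (0 < M)%N by rewrite eM addn_gt0 orbC.
exists (M%:R `^ 21^-1)^-1; first by rewrite invr_gt0; apply: powR_gt0; rewrite ltr0n.
move=> T e se ce te cT; have [C lC] := exists_longest_cycle se ce te cT.
exists C; first by case: lC => uC cC sC _; split=> //; rewrite /ucycle cC.
exact: root21_bound M0 (longest_cycle_bound se ce te cT eM lC).
Qed.
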